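(* Let $\mathcal{C}$ be a locally presentable category. Then the following holds. (1) $\mathcal{C}$ has all abelianizations: for every object $X$ of $\mathcal{C}$, the forgetful functor $U_X \colon (\mathcal{C}/X)_{\mathrm{ab}} \to \mathcal{C}/X$ has a left adjoint $Ab_X \colon \mathcal{C}/X \to (\mathcal{C}/X)_{\mathrm{ab}}$. (2) $\mathcal{C}$ has all pushforwards: for every map $f \colon X \to Y$ in $\mathcal{C}$, the pullback functor $f^* \colon (\mathcal{C}/Y)_{\mathrm{ab}} \to (\mathcal{C}/X)_{\mathrm{ab}}$ has a left adjoint $f_{\sharp} \colon (\mathcal{C}/X)_{\mathrm{ab}} \to (\mathcal{C}/Y)_{\mathrm{ab}}$.
   Context: All categories are locally small. For a category $\mathcal{E}$ with finite products, $\mathcal{E}_{\mathrm{ab}}$ denotes the category of abelian group objects in $\mathcal{E}$. For an object $X$ of $\mathcal{C}$, $\mathcal{C}/X$ is the slice category, and $(\mathcal{C}/X)_{\mathrm{ab}}$ is the category of Beck modules over $X$. For $f \colon X \to Y$, the pullback functor $f^* \colon \mathcal{C}/Y \to \mathcal{C}/X$ preserves limits, and hence induces a functor $f^* \colon (\mathcal{C}/Y)_{\mathrm{ab}} \to (\mathcal{C}/X)_{\mathrm{ab}}$ on abelian group objects. For a regular cardinal $\kappa$, a category is locally $\kappa$-presentable if it is cocomplete and has a set $\mathcal{G}$ of $\kappa$-presentable objects (objects $G$ such that $\mathrm{Hom}(G,-)$ preserves $\kappa$-filtered colimits) such that every object is a $\kappa$-filtered colimit of objects from $\mathcal{G}$;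 it is locally presentable if it is locally $\kappa$-presentable for some regular cardinal $\kappa$. *)

(* Defs.v *)
From Stdlib Require Import FunctionalExtensionality ProofIrrelevance ClassicalEpsilon.

Set Implicit Arguments.
Unset Strict Implicit.
Unset Printing Implicit Defensive.

(** * Categories *)

(* [Small] is a fixed universe whose inhabitants play the role of sets, as
   opposed to classes: all hom-types live in it (so every [category] is locally
   small), while a collection of objects may be large. *)
Definition Small := Type.

Record category_on (O : Type) := CategoryOn {
  hom_on : O -> O -> Small;
  id_on : forall A, hom_on A A;
  comp_on : forall A B C, hom_on B C -> hom_on A B -> hom_on A C;
  comp_on_1l : forall A B (f : hom_on A B), comp_on (id_on B) f = f;
  comp_on_1r : forall A B (f : hom_on A B), comp_on f (id_on A) = f;
  comp_on_A : forall A B C D (h : hom_on C D) (g : hom_on B C) (f : hom_on A B),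
    comp_on h (comp_on g f) = comp_on (comp_on h g) f
}.

Record category := Category { Obj :> Type; cat_on : category_on Obj }.

Record small_category := SmallCategory {
  small_obj : Small;
  small_cat_on : category_on small_obj
}.

Coercion category_of_small (J : small_category) : category :=
  Category (small_cat_on J).

Definition hom (C : category) (A B : C) : Small := hom_on (cat_on C) A B.
Definition idm (C : category) (A : C) : hom A A := id_on (cat_on C) A.
Definition comp (C : category) (A B D : C) (g : hom B D) (f : hom A B) :
  hom A D := comp_on g f.

Notation "A ~> B" := (hom A B) (at level 90, right associativity).
Notation "g ∘ f" := (comp g f) (at level 40, left associativity).

Lemma comp_1l (C : category) (A B : C) (f : A ~> B) : idm B ∘ f = f.
Proof. apply comp_on_1l. Qed.

Lemma comp_1r (C : category) (A B : C) (f : A ~> B) : f ∘ idm A = f.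
Proof. apply comp_on_1r. Qed.

Lemma comp_A (C : category) (A B D E : C) (h : D ~> E) (g : B ~> D) (f : A ~> B) :
  h ∘ (g ∘ f) = h ∘ g ∘ f.
Proof. apply comp_on_A. Qed.

Lemma comp_eql (C : category) (A B D E : C) (h : D ~> E) (g : B ~> D) (f : A ~> B)
  (k : B ~> E) : h ∘ g = k -> h ∘ (g ∘ f) = k ∘ f.
Proof. intros <-. apply comp_A. Qed.

Record functor (C D : category) := Functor {
  fobj :> C -> D;
  fmap : forall A B : C, (A ~> B) -> (fobj A ~> fobj B);
  fmap_id : forall A : C, fmap (idm A) = idm (fobj A);
  fmap_comp : forall (A B E : C) (g : B ~> E) (f : A ~> B),
    fmap (g ∘ f) = fmap g ∘ fmap f
}.

Definition functor_id (C : category) : functor C C :=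
  @Functor C C (fun A => A) (fun A B f => f)
    (fun A => eq_refl) (fun A B E g f => eq_refl).

Definition functor_comp (C D E : category) (G : functor D E) (F : functor C D) :
  functor C E.
Proof.
refine (@Functor C E (fun A => G (F A)) (fun A B f => fmap G (fmap F f)) _ _).
- intros A. rewrite fmap_id. apply fmap_id.
- intros A B K g f. rewrite fmap_comp. apply fmap_comp.
Defined.

Record nat_trans (C D : category) (F G : functor C D) := NatTrans {
  component :> forall A : C, F A ~> G A;
  naturality : forall (A B : C) (f : A ~> B),
    component B ∘ fmap F f = fmap G f ∘ component A
}.

Record adjunction (C D : category) (L : functor C D) (R : functor D C) :=
Adjunction {
  adj_unit : nat_trans (functor_id C) (functor_comp R L);
  adj_counit : nat_trans (functor_comp L R) (functor_id D);
  adj_triangle_l : forall A : C,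
    adj_counit (L A) ∘ fmap L (adj_unit A) = idm (L A);
  adj_triangle_r : forall B : D,
    fmap R (adj_counit B) ∘ adj_unit (R B) = idm (R B)
}.

Definition has_left_adjoint (C D : category) (R : functor D C) : Prop :=
  exists L : functor C D, inhabited (adjunction L R).

(** * Colimits *)

Record cocone (J C : category) (F : functor J C) := Cocone {
  apex : C;
  leg : forall j : J, F j ~> apex;
  leg_nat : forall (i j : J) (a : i ~> j), leg j ∘ fmap F a = leg i
}.

Definition is_colimit (J C : category) (F : functor J C) (c : cocone F) : Prop :=
  forall c' : cocone F,
    exists! h : apex c ~> apex c', forall j : J, h ∘ leg c j = leg c' j.

Definition cocomplete (C : category) : Prop :=
  forall (J : small_category) (F : functor J C),
    exists c : cocone F, is_colimit c.

Definition map_cocone (J C D : category) (G : functor C D) (F : functor J C)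
  (c : cocone F) : cocone (functor_comp G F).
Proof.
refine (@Cocone J D (functor_comp G F) (G (apex c)) (fun j => fmap G (leg c j)) _).
intros i j a. simpl. rewrite <- fmap_comp. f_equal. apply leg_nat.
Defined.

(** * Locally presentable categories *)

(* Cardinals are represented by types, compared by injections. *)
Definition card_le (A B : Small) : Prop :=
  exists f : A -> B, forall x y, f x = f y -> x = y.

Definition card_lt (A B : Small) : Prop := card_le A B /\ ~ card_le B A.

Definition regular_cardinal (K : Small) : Prop :=
  card_le nat K /\
  forall (I : Small) (A : I -> Small),
    card_lt I K -> (forall i, card_lt (A i) K) -> card_lt {i : I & A i} K.

Definition arrows (S : small_category) : Small :=
  {x : small_obj S & {y : small_obj S & hom_on (small_cat_on S) x y}}.

Definition filtered (K : Small) (J : small_category) : Prop :=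
  forall (S : small_category) (F : functor S J),
    card_lt (arrows S) K -> inhabited (cocone F).

Definition sets : category :=
  Category (@CategoryOn Small (fun A B => A -> B)
    (fun A x => x) (fun A B C g f x => g (f x))
    (fun A B f => eq_refl) (fun A B f => eq_refl)
    (fun A B C D h g f => eq_refl)).

Definition hom_functor (C : category) (G : C) : functor C sets.
Proof.
refine (@Functor C sets (fun A => G ~> A) (fun A B f g => f ∘ g) _ _).
- intros A. apply functional_extensionality. intros g. apply comp_1l.
- intros A B E g f. apply functional_extensionality. intros h.
  symmetry. apply comp_A.
Defined.

Definition presentable (K : Small) (C : category) (G : C) : Prop :=
  forall (J : small_category) (F : functor J C) (c : cocone F),
    filtered K J -> is_colimit c -> is_colimit (map_cocone (hom_functor G) c).

Definition locally_presentable_at (K : Small) (C : category) : Prop :=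
  cocomplete C /\
  exists (I : Small) (G : I -> C),
    (forall i, presentable K (G i)) /\
    forall X : C,
      exists (J : small_category) (F : functor J C) (c : cocone F),
        filtered K J /\ (forall j : J, exists i, G i = F j) /\
        is_colimit c /\ apex c = X.

Definition locally_presentable (C : category) : Prop :=
  exists K : Small, regular_cardinal K /\ locally_presentable_at K C.

(** * Finite products and abelian group objects *)

Record fin_products (E : category) := FinProducts {
  term : E;
  bang : forall T : E, T ~> term;
  bang_eq : forall (T : E) (u v : T ~> term), u = v;
  prd : E -> E -> E;
  pr1 : forall A B : E, prd A B ~> A;
  pr2 : forall A B : E, prd A B ~> B;
  pair : forall (A B T : E), (T ~> A) -> (T ~> B) -> (T ~> prd A B);
  pr1_pair : forall (A B T : E) (u : T ~> A) (v : T ~> B), pr1 A B ∘ pair u v = u;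
  pr2_pair : forall (A B T : E) (u : T ~> A) (v : T ~> B), pr2 A B ∘ pair u v = v;
  pair_eq : forall (A B T : E) (u v : T ~> prd A B),
    pr1 A B ∘ u = pr1 A B ∘ v -> pr2 A B ∘ u = pr2 A B ∘ v -> u = v
}.

Record ab_object (E : category) (FP : fin_products E) := AbObject {
  ab_carrier : E;
  ab_mul : prd FP ab_carrier ab_carrier ~> ab_carrier;
  ab_unit : term FP ~> ab_carrier;
  ab_inv : ab_carrier ~> ab_carrier;
  (* both sides are maps (A × A) × A ~> A *)
  ab_assoc :
    let AA := prd FP ab_carrier ab_carrier in
    let x := pr1 FP ab_carrier ab_carrier ∘ pr1 FP AA ab_carrier in
    let y := pr2 FP ab_carrier ab_carrier ∘ pr1 FP AA ab_carrier in
    let z := pr2 FP AA ab_carrier in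
    ab_mul ∘ pair FP (ab_mul ∘ pair FP x y) z =
    ab_mul ∘ pair FP x (ab_mul ∘ pair FP y z);
  ab_mul1 : ab_mul ∘ pair FP (idm ab_carrier) (ab_unit ∘ bang FP ab_carrier)
            = idm ab_carrier;
  ab_mulV : ab_mul ∘ pair FP (idm ab_carrier) ab_inv
            = ab_unit ∘ bang FP ab_carrier;
  ab_mulC : ab_mul ∘ pair FP (pr2 FP ab_carrier ab_carrier)
                             (pr1 FP ab_carrier ab_carrier) = ab_mul
}.

(* As for ordinary groups, preservation of the unit and of inverses follows from
   preservation of the multiplication. *)
Record ab_hom (E : category) (FP : fin_products E) (A B : ab_object FP) := AbHom {
  ab_map :> ab_carrier A ~> ab_carrier B;
  ab_map_mul :
    ab_map ∘ ab_mul A =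
    ab_mul B ∘ pair FP (ab_map ∘ pr1 FP (ab_carrier A) (ab_carrier A))
                       (ab_map ∘ pr2 FP (ab_carrier A) (ab_carrier A))
}.

Lemma ab_hom_eq (E : category) (FP : fin_products E) (A B : ab_object FP)
  (f g : ab_hom A B) : ab_map f = ab_map g -> f = g.
Proof.
destruct f as [f Hf], g as [g Hg]. simpl. intros ->.
f_equal. apply proof_irrelevance.
Qed.

Lemma pair_comp (E : category) (FP : fin_products E) (A B T S : E)
  (u : T ~> A) (v : T ~> B) (w : S ~> T) :
  pair FP u v ∘ w = pair FP (u ∘ w) (v ∘ w).
Proof.
apply pair_eq; rewrite comp_A.
- rewrite !pr1_pair. reflexivity.
- rewrite !pr2_pair. reflexivity.
Qed.

Definition ab_hom_id (E : category) (FP : fin_products E) (A : ab_object FP) :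
  ab_hom A A.
Proof.
refine (@AbHom E FP A A (idm _) _).
rewrite !comp_1l.
replace (pair FP _ _) with (idm (prd FP (ab_carrier A) (ab_carrier A))).
- rewrite comp_1r. reflexivity.
- apply pair_eq.
  + rewrite pr1_pair. apply comp_1r.
  + rewrite pr2_pair. apply comp_1r.
Defined.

Definition ab_hom_comp (E : category) (FP : fin_products E) (A B C : ab_object FP)
  (g : ab_hom B C) (f : ab_hom A B) : ab_hom A C.
Proof.
refine (@AbHom E FP A C (ab_map g ∘ ab_map f) _).
rewrite <- comp_A, ab_map_mul, comp_A, ab_map_mul, <- comp_A, pair_comp.
f_equal. rewrite <- !comp_A, pr1_pair, pr2_pair. reflexivity.
Defined.

Definition ab_category (E : category) (FP : fin_products E) : category.
Proof.
refine (Category (@CategoryOn (ab_object FP) (@ab_hom E FP)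
  (@ab_hom_id E FP) (@ab_hom_comp E FP) _ _ _)).
- intros A B f. apply ab_hom_eq, comp_1l.
- intros A B f. apply ab_hom_eq, comp_1r.
- intros A B C D h g f. apply ab_hom_eq, comp_A.
Defined.

Definition ab_forget (E : category) (FP : fin_products E) :
  functor (ab_category FP) E :=
  @Functor (ab_category FP) E (fun A : ab_object FP => ab_carrier A)
    (fun A B (f : ab_hom A B) => ab_map f)
    (fun A => eq_refl) (fun A B C g f => eq_refl).

(* Invertibility of the canonical maps F (A × B) ~> F A × F B and F 1 ~> 1. *)
Record preserves_fin_products (E E' : category) (FP : fin_products E)
  (FP' : fin_products E') (F : functor E E') := PreservesFinProducts {
  pfp_prd : forall A B : E, prd FP' (F A) (F B) ~> F (prd FP A B);
  pfp_prdK : forall A B : E,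
    pair FP' (fmap F (pr1 FP A B)) (fmap F (pr2 FP A B)) ∘ pfp_prd A B = idm _;
  pfp_prdVK : forall A B : E,
    pfp_prd A B ∘ pair FP' (fmap F (pr1 FP A B)) (fmap F (pr2 FP A B)) = idm _;
  pfp_term : term FP' ~> F (term FP);
  pfp_termVK : pfp_term ∘ bang FP' (F (term FP)) = idm _
}.

Section InducedFunctor.
Context (E E' : category) (FP : fin_products E) (FP' : fin_products E').
Context (F : functor E E') (HF : preserves_fin_products FP FP' F).

Lemma pfp_pr1 (A B : E) :
  fmap F (pr1 FP A B) ∘ pfp_prd HF A B = pr1 FP' (F A) (F B).
Proof.
rewrite <- (comp_1r (pr1 FP' _ _)), <- (pfp_prdK HF A B), comp_A, pr1_pair.
reflexivity.
Qed.

Lemma pfp_pr2 (A B : E) :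
  fmap F (pr2 FP A B) ∘ pfp_prd HF A B = pr2 FP' (F A) (F B).
Proof.
rewrite <- (comp_1r (pr2 FP' _ _)), <- (pfp_prdK HF A B), comp_A, pr2_pair.
reflexivity.
Qed.

Lemma pfp_pair (A B T : E) (S : E') (u : T ~> A) (v : T ~> B) (t : S ~> F T) :
  pfp_prd HF A B ∘ pair FP' (fmap F u ∘ t) (fmap F v ∘ t) =
  fmap F (pair FP u v) ∘ t.
Proof.
rewrite <- (comp_1l (fmap F (pair FP u v))), <- (pfp_prdVK HF A B).
rewrite <- !comp_A. f_equal.
rewrite pair_comp, !comp_A, <- !fmap_comp, pr1_pair, pr2_pair. reflexivity.
Qed.

Lemma pfp_pair0 (A B T : E) (u : T ~> A) (v : T ~> B) :
  pfp_prd HF A B ∘ pair FP' (fmap F u) (fmap F v) = fmap F (pair FP u v).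
Proof.
rewrite <- (comp_1r (fmap F u)), <- (comp_1r (fmap F v)), pfp_pair.
apply comp_1r.
Qed.

Lemma pfp_bang (T : E) :
  pfp_term HF ∘ bang FP' (F T) = fmap F (bang FP T).
Proof.
rewrite <- (comp_1l (fmap F (bang FP T))), <- (pfp_termVK HF), <- comp_A.
f_equal. apply bang_eq.
Qed.

Definition ab_functor_obj (A : ab_object FP) : ab_object FP'.
Proof.
refine (@AbObject E' FP' (F (ab_carrier A))
  (fmap F (ab_mul A) ∘ pfp_prd HF _ _)
  (fmap F (ab_unit A) ∘ pfp_term HF)
  (fmap F (ab_inv A)) _ _ _ _).
- set (X := ab_carrier A). intros AA x y z.
  set (t := pfp_prd HF (prd FP X X) X ∘
            pair FP' (pfp_prd HF X X ∘ pr1 FP' AA (F X)) z).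
  assert (Hz : z = fmap F (pr2 FP (prd FP X X) X) ∘ t).
  { unfold t. rewrite comp_A, pfp_pr2, pr2_pair. reflexivity. }
  assert (Hxy : pfp_prd HF X X ∘ pr1 FP' AA (F X) =
                fmap F (pr1 FP (prd FP X X) X) ∘ t).
  { unfold t. rewrite comp_A, pfp_pr1, pr1_pair. reflexivity. }
  assert (Hx : x = fmap F (pr1 FP X X ∘ pr1 FP (prd FP X X) X) ∘ t).
  { rewrite fmap_comp, <- comp_A, <- Hxy, comp_A, pfp_pr1. reflexivity. }
  assert (Hy : y = fmap F (pr2 FP X X ∘ pr1 FP (prd FP X X) X) ∘ t).
  { rewrite fmap_comp, <- comp_A, <- Hxy, comp_A, pfp_pr2. reflexivity. }
  rewrite Hx, Hy, Hz.
  assert (Hm : forall u v : prd FP (prd FP X X) X ~> X,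
    fmap F (ab_mul A) ∘ pfp_prd HF X X ∘ pair FP' (fmap F u ∘ t) (fmap F v ∘ t) =
    fmap F (ab_mul A ∘ pair FP u v) ∘ t).
  { intros u v. rewrite <- comp_A, pfp_pair, comp_A, <- fmap_comp. reflexivity. }
  rewrite !Hm.
  do 2 f_equal. apply ab_assoc.
- rewrite <- (comp_A (fmap F (ab_unit A))), pfp_bang, <- fmap_comp, <- fmap_id.
  rewrite <- comp_A, pfp_pair0, <- fmap_comp, ab_mul1. reflexivity.
- rewrite <- (comp_A (fmap F (ab_unit A))), pfp_bang, <- fmap_comp, <- fmap_id.
  rewrite <- comp_A, pfp_pair0, <- fmap_comp, ab_mulV. reflexivity.
- rewrite <- comp_A, <- pfp_pr1, <- pfp_pr2, pfp_pair, comp_A, <- fmap_comp.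
  rewrite ab_mulC. reflexivity.
Defined.

Definition ab_functor_map (A B : ab_object FP) (f : ab_hom A B) :
  ab_hom (ab_functor_obj A) (ab_functor_obj B).
Proof.
refine (@AbHom E' FP' (ab_functor_obj A) (ab_functor_obj B) (fmap F (ab_map f)) _).
simpl. rewrite comp_A, <- fmap_comp, ab_map_mul, fmap_comp, <- !comp_A.
f_equal. rewrite <- pfp_pr1, <- pfp_pr2, !comp_A, <- !fmap_comp, pfp_pair.
reflexivity.
Defined.

Definition ab_functor : functor (ab_category FP) (ab_category FP').
Proof.
refine (@Functor (ab_category FP) (ab_category FP')
  ab_functor_obj ab_functor_map _ _).
- intros A. apply ab_hom_eq. apply (fmap_id F).
- intros A B C g f. apply ab_hom_eq. apply (fmap_comp F).
Defined.

End InducedFunctor.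

(** * Pullbacks, slices and Beck modules *)

Record pullback (C : category) (A B Z : C) (f : A ~> Z) (g : B ~> Z) := Pullback {
  pb_obj : C;
  pb_fst : pb_obj ~> A;
  pb_snd : pb_obj ~> B;
  pb_comm : f ∘ pb_fst = g ∘ pb_snd;
  pb_lift : forall (T : C) (u : T ~> A) (v : T ~> B),
    f ∘ u = g ∘ v -> (T ~> pb_obj);
  pb_fst_lift : forall (T : C) (u : T ~> A) (v : T ~> B) (e : f ∘ u = g ∘ v),
    pb_fst ∘ pb_lift e = u;
  pb_snd_lift : forall (T : C) (u : T ~> A) (v : T ~> B) (e : f ∘ u = g ∘ v),
    pb_snd ∘ pb_lift e = v;
  pb_eq : forall (T : C) (u v : T ~> pb_obj),
    pb_fst ∘ u = pb_fst ∘ v -> pb_snd ∘ u = pb_snd ∘ v -> u = v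
}.

(* A choice of pullbacks; one exists in every locally presentable category, see
   [locally_presentable_pullbacks] below. *)
Definition pullbacks (C : category) : Type :=
  forall (A B Z : C) (f : A ~> Z) (g : B ~> Z), pullback f g.

Section Slice.
Context (C : category).

Record slice_obj (X : C) := SliceObj { s_dom : C; s_arr : s_dom ~> X }.

Record slice_hom (X : C) (A B : slice_obj X) := SliceHom {
  s_map : s_dom A ~> s_dom B;
  s_map_comm : s_arr B ∘ s_map = s_arr A
}.

Lemma slice_hom_eq (X : C) (A B : slice_obj X) (f g : slice_hom A B) :
  s_map f = s_map g -> f = g.
Proof.
destruct f as [f Hf], g as [g Hg]. simpl. intros ->.
f_equal. apply proof_irrelevance.
Qed.

Definition slice_id (X : C) (A : slice_obj X) : slice_hom A A :=
  @SliceHom X A A (idm (s_dom A)) (comp_1r (s_arr A)).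

Definition slice_comp (X : C) (A B D : slice_obj X)
  (g : slice_hom B D) (f : slice_hom A B) : slice_hom A D.
Proof.
refine (@SliceHom X A D (s_map g ∘ s_map f) _).
rewrite comp_A, s_map_comm. apply s_map_comm.
Defined.

Definition slice (X : C) : category.
Proof.
refine (Category (@CategoryOn (slice_obj X) (@slice_hom X)
  (@slice_id X) (@slice_comp X) _ _ _)).
- intros A B f. apply slice_hom_eq, comp_1l.
- intros A B f. apply slice_hom_eq, comp_1r.
- intros A B D K h g f. apply slice_hom_eq, comp_A.
Defined.

Context (P : pullbacks C).

Definition slice_prd (X : C) (A B : slice_obj X) : slice_obj X :=
  SliceObj (s_arr A ∘ pb_fst (P (s_arr A) (s_arr B))).

Definition slice_term (X : C) : slice_obj X := SliceObj (idm X).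

Definition slice_bang (X : C) (T : slice_obj X) : slice_hom T (slice_term X) :=
  @SliceHom X T (slice_term X) (s_arr T) (comp_1l (s_arr T)).

Definition slice_pr1 (X : C) (A B : slice_obj X) : slice_hom (slice_prd A B) A :=
  @SliceHom X (slice_prd A B) A (pb_fst (P (s_arr A) (s_arr B))) eq_refl.

Definition slice_pr2 (X : C) (A B : slice_obj X) : slice_hom (slice_prd A B) B :=
  @SliceHom X (slice_prd A B) B (pb_snd (P (s_arr A) (s_arr B)))
    (eq_sym (pb_comm (P (s_arr A) (s_arr B)))).

Definition slice_pair (X : C) (A B T : slice_obj X)
  (u : slice_hom T A) (v : slice_hom T B) : slice_hom T (slice_prd A B).
Proof.
assert (e : s_arr A ∘ s_map u = s_arr B ∘ s_map v).
{ rewrite !s_map_comm. reflexivity. }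
refine (@SliceHom X T (slice_prd A B) (pb_lift (P (s_arr A) (s_arr B)) e) _).
simpl. rewrite <- comp_A, pb_fst_lift. apply s_map_comm.
Defined.

Definition slice_fin_products (X : C) : fin_products (slice X).
Proof.
refine (@FinProducts (slice X) (slice_term X) (@slice_bang X) _
  (@slice_prd X) (@slice_pr1 X) (@slice_pr2 X) (@slice_pair X) _ _ _).
- intros T u v. apply slice_hom_eq.
  rewrite <- (comp_1l (s_map u)), <- (comp_1l (s_map v)).
  transitivity (s_arr (T : slice_obj X)); [|symmetry]; apply s_map_comm.
- intros A B T u v. apply slice_hom_eq. apply pb_fst_lift.
- intros A B T u v. apply slice_hom_eq. apply pb_snd_lift.
- intros A B T u v e1 e2. apply slice_hom_eq. apply pb_eq.
  + exact (f_equal (@s_map X _ _) e1).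
  + exact (f_equal (@s_map X _ _) e2).
Defined.

Definition pullback_obj (X Y : C) (f : X ~> Y) (A : slice_obj Y) : slice_obj X :=
  SliceObj (pb_fst (P f (s_arr A))).

Definition pullback_map (X Y : C) (f : X ~> Y) (A B : slice_obj Y)
  (h : slice_hom A B) : slice_hom (pullback_obj f A) (pullback_obj f B).
Proof.
unshelve refine (@SliceHom X (pullback_obj f A) (pullback_obj f B)
  (@pb_lift _ _ _ _ _ _ (P f (s_arr B)) _
     (pb_fst (P f (s_arr A))) (s_map h ∘ pb_snd (P f (s_arr A))) _) _).
- rewrite comp_A, s_map_comm. apply pb_comm.
- apply pb_fst_lift.
Defined.

Definition pullback_functor (X Y : C) (f : X ~> Y) : functor (slice Y) (slice X).
Proof.
refine (@Functor (slice Y) (slice X) (pullback_obj f) (@pullback_map X Y f) _ _).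
- intros A. apply slice_hom_eq, pb_eq.
  + etransitivity; [apply pb_fst_lift|]. symmetry. apply comp_1r.
  + etransitivity; [apply pb_snd_lift|].
    etransitivity; [apply comp_1l|]. symmetry. apply comp_1r.
- intros A B D h g. apply slice_hom_eq, pb_eq.
  + etransitivity; [apply pb_fst_lift|]. symmetry.
    etransitivity; [apply comp_A|]. simpl. rewrite !pb_fst_lift. reflexivity.
  + etransitivity; [apply pb_snd_lift|]. symmetry.
    etransitivity; [apply comp_A|]. simpl.
    rewrite pb_snd_lift, <- (comp_A (s_map h)), pb_snd_lift. apply comp_A.
Defined.

Definition pullback_preserves (X Y : C) (f : X ~> Y) :
  preserves_fin_products (slice_fin_products Y) (slice_fin_products X)
    (pullback_functor f).
Proof.
assert (H1 : forall A B : slice_obj Y,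
  let p := P (pb_fst (P f (s_arr A))) (pb_fst (P f (s_arr B))) in
  s_arr A ∘ (pb_snd (P f (s_arr A)) ∘ pb_fst p) =
  s_arr B ∘ (pb_snd (P f (s_arr B)) ∘ pb_snd p)).
{ intros A B p. rewrite !comp_A, <- !pb_comm, <- !comp_A. f_equal. apply pb_comm. }
assert (H2 : forall A B : slice_obj Y,
  let p := P (pb_fst (P f (s_arr A))) (pb_fst (P f (s_arr B))) in
  f ∘ (pb_fst (P f (s_arr A)) ∘ pb_fst p) =
  s_arr A ∘ pb_fst (P (s_arr A) (s_arr B)) ∘ pb_lift _ (H1 A B)).
{ intros A B p. rewrite <- (comp_A (s_arr A)), pb_fst_lift, !comp_A.
  f_equal. apply pb_comm. }
assert (H3 : f ∘ idm X = idm Y ∘ f).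
{ rewrite comp_1l. apply comp_1r. }
set (phi := fun A B : slice_obj Y =>
  @SliceHom X (slice_prd (pullback_obj f A) (pullback_obj f B))
    (pullback_obj f (slice_prd A B)) (pb_lift _ (H2 A B)) (pb_fst_lift _ _)).
refine (@PreservesFinProducts (slice Y) (slice X)
  (slice_fin_products Y) (slice_fin_products X) (pullback_functor f) phi _ _
  (@SliceHom X (slice_term X) (pullback_obj f (slice_term Y))
    (pb_lift (P f (idm Y)) H3) (pb_fst_lift _ _)) _).
- intros A B. set (p := P (pb_fst (P f (s_arr A))) (pb_fst (P f (s_arr B)))).
  assert (E1 : pb_fst (P f (s_arr (slice_prd A B))) ∘ s_map (phi A B) =
               pb_fst (P f (s_arr A)) ∘ pb_fst p) by apply pb_fst_lift.
  assert (E2 : pb_snd (P f (s_arr (slice_prd A B))) ∘ s_map (phi A B) =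
               pb_lift _ (H1 A B)) by apply pb_snd_lift.
  apply pair_eq; rewrite comp_A, comp_1r.
  + rewrite pr1_pair. apply slice_hom_eq, pb_eq.
    * etransitivity; [apply comp_eql, pb_fst_lift|]. exact E1.
    * etransitivity; [apply comp_eql, pb_snd_lift|].
      etransitivity; [symmetry; apply comp_A|].
      etransitivity; [apply (f_equal (fun k => _ ∘ k) E2)|]. apply pb_fst_lift.
  + rewrite pr2_pair. apply slice_hom_eq, pb_eq.
    * etransitivity; [apply comp_eql, pb_fst_lift|].
      etransitivity; [exact E1|]. apply pb_comm.
    * etransitivity; [apply comp_eql, pb_snd_lift|].
      etransitivity; [symmetry; apply comp_A|].
      etransitivity; [apply (f_equal (fun k => _ ∘ k) E2)|]. apply pb_snd_lift.
- intros A B. apply slice_hom_eq, pb_eq; (etransitivity; [|symmetry; apply comp_1r]).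
  + etransitivity; [apply comp_eql, pb_fst_lift|].
    etransitivity; [symmetry; apply comp_A|].
    etransitivity; [apply f_equal, pb_fst_lift|]. apply pb_fst_lift.
  + etransitivity; [apply comp_eql, pb_snd_lift|]. apply pb_eq.
    * etransitivity; [apply comp_eql, pb_fst_lift|].
      etransitivity; [symmetry; apply comp_A|].
      etransitivity; [apply f_equal, pb_fst_lift|]. apply pb_snd_lift.
    * etransitivity; [apply comp_eql, pb_snd_lift|].
      etransitivity; [symmetry; apply comp_A|].
      etransitivity; [apply f_equal, pb_snd_lift|]. apply pb_snd_lift.
- apply slice_hom_eq, pb_eq; (etransitivity; [|symmetry; apply comp_1r]).
  + etransitivity; [apply comp_eql, pb_fst_lift|]. apply comp_1l.
  + etransitivity; [apply comp_eql, pb_snd_lift|].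
    etransitivity; [apply pb_comm|]. apply comp_1l.
Defined.

Definition beck_modules (X : C) : category := ab_category (slice_fin_products X).

Definition beck_forget (X : C) : functor (beck_modules X) (slice X) :=
  ab_forget (slice_fin_products X).

Definition beck_pullback (X Y : C) (f : X ~> Y) :
  functor (beck_modules Y) (beck_modules X) :=
  ab_functor (pullback_preserves f).

End Slice.

(** * Locally presentable categories have pullbacks *)

(* A small category with objects [false] and [true], and with [I] as the type of
   arrows from [false] to [true]. *)
Definition parallel_hom (I : Small) (b b' : bool) : Small :=
  match b, b' with
  | false, true => I
  | true, false => Empty_set
  | _, _ => unit
  end.

Definition parallel (I : Small) : small_category.
Proof.
unshelve refine (@SmallCategory bool (@CategoryOn bool (parallel_hom I) _ _ _ _ _)).
- intros []; exact tt.
- intros [] [] [] g f; simpl in *; solve [exact tt | destruct f | destruct g | assumption].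
- intros [] [] f; simpl in *; try destruct f; reflexivity.
- intros [] [] f; simpl in *; try destruct f; reflexivity.
- intros [] [] [] [] h g f; simpl in *; try destruct f; try destruct g; try destruct h;
  reflexivity.
Defined.

Definition parallel_functor (C : category) (A B : C) (I : Small) (u : I -> (A ~> B)) :
  functor (parallel I) C.
Proof.
unshelve refine (@Functor (parallel I) C (fun b : bool => if b then B else A) _ _ _).
- intros [] [] f; [exact (idm B) | destruct f | exact (u f) | exact (idm A)].
- intros []; reflexivity.
- intros [] [] [] g f; simpl in *; try destruct g; try destruct f; symmetry;
    solve [apply comp_1l | apply comp_1r].
Defined.

Lemma coequalizer (C : category) (A B : C) (I : Small) (i0 : I) (u : I -> (A ~> B)) :
  cocomplete C ->
  exists (Q : C) (q : B ~> Q),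
    (forall i j, q ∘ u i = q ∘ u j) /\
    forall (T : C) (t : B ~> T), (forall i j, t ∘ u i = t ∘ u j) ->
      exists! r : Q ~> T, r ∘ q = t.
Proof.
intros hC. destruct (hC (parallel I) (parallel_functor u)) as [c Hc].
exists (apex c), (leg c true).
assert (Hu : forall i, leg c true ∘ u i = leg c false).
{ intros i. exact (leg_nat c (i := false) (j := true) i). }
split. { intros i j. rewrite !Hu. reflexivity. }
intros T t Ht.
unshelve epose (c' := @Cocone (parallel I) C (parallel_functor u) T
  (fun b : bool => match b with true => t | false => t ∘ u i0 end) _).
{ intros [] [] f; simpl in *; try destruct f.
  - apply comp_1r.
  - apply Ht.
  - apply comp_1r. }
destruct (Hc c') as [r [Hr Hr']].
exists r. split. { exact (Hr true). }
intros r' Er. apply Hr'. intros []; simpl.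
- exact Er.
- rewrite <- (Hu i0). etransitivity; [apply comp_A|].
  apply (f_equal (fun x => x ∘ u i0) Er).
Qed.

Section Pullbacks.
Context (C : category) (hC : cocomplete C) (I : Small) (G : I -> C).
Context (HG : forall X : C, exists (J : small_category) (F : functor J C) (c : cocone F),
  (forall j : J, exists i, G i = F j) /\ is_colimit c /\ apex c = X).
Context (A B Z : C) (f : A ~> Z) (g : B ~> Z).

(* Spans over the cospan (f, g), with apex in the family G. *)
Definition span_obj : Small :=
  {i : I & {p : (G i ~> A) & {q : (G i ~> B) | f ∘ p = g ∘ q}}}.
Definition span_pr1 (x : span_obj) : G (projT1 x) ~> A := projT1 (projT2 x).
Definition span_pr2 (x : span_obj) : G (projT1 x) ~> B := proj1_sig (projT2 (projT2 x)).
Lemma span_comm (x : span_obj) : f ∘ span_pr1 x = g ∘ span_pr2 x.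
Proof. exact (proj2_sig (projT2 (projT2 x))). Qed.

Definition span_hom (x y : span_obj) : Small :=
  {h : G (projT1 x) ~> G (projT1 y) |
    span_pr1 y ∘ h = span_pr1 x /\ span_pr2 y ∘ h = span_pr2 x}.

Lemma span_hom_eq (x y : span_obj) (h k : span_hom x y) :
  proj1_sig h = proj1_sig k -> h = k.
Proof.
destruct h as [h Hh], k as [k Hk]. simpl. intros ->. f_equal. apply proof_irrelevance.
Qed.

Definition span_id (x : span_obj) : span_hom x x :=
  exist _ (idm (G (projT1 x))) (conj (comp_1r (span_pr1 x)) (comp_1r (span_pr2 x))).

Definition span_comp (x y z : span_obj) (k : span_hom y z) (h : span_hom x y) :
  span_hom x z.
Proof.
exists (proj1_sig k ∘ proj1_sig h).
destruct h as [h [h1 h2]], k as [k [k1 k2]]. simpl.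
rewrite !comp_A, k1, k2. split; assumption.
Defined.

Definition span_category : small_category.
Proof.
refine (@SmallCategory span_obj (@CategoryOn span_obj span_hom span_id span_comp _ _ _)).
- intros x y h. apply span_hom_eq, comp_1l.
- intros x y h. apply span_hom_eq, comp_1r.
- intros x y z w h k l. apply span_hom_eq, comp_A.
Defined.

Definition span_functor : functor span_category C :=
  @Functor span_category C (fun x : span_obj => G (projT1 x))
    (fun x y (h : span_hom x y) => proj1_sig h)
    (fun x => eq_refl) (fun x y z k h => eq_refl).

Lemma weak_pullback :
  exists (W : C) (p : W ~> A) (q : W ~> B), f ∘ p = g ∘ q /\
    forall (T : C) (u : T ~> A) (v : T ~> B), f ∘ u = g ∘ v ->
      exists t : T ~> W, p ∘ t = u /\ q ∘ t = v.
Proof.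
destruct (hC span_functor) as [c Hc].
unshelve epose (cA := @Cocone span_category C span_functor A span_pr1 _).
{ intros x y h. exact (proj1 (proj2_sig h)). }
unshelve epose (cB := @Cocone span_category C span_functor B span_pr2 _).
{ intros x y h. exact (proj2 (proj2_sig h)). }
unshelve epose (cZ := @Cocone span_category C span_functor Z
  (fun x : span_obj => f ∘ span_pr1 x) _).
{ intros x y h. simpl.
  etransitivity; [symmetry; apply comp_A|]. apply f_equal.
  exact (proj1 (proj2_sig h)). }
destruct (Hc cA) as [p [Hp _]], (Hc cB) as [q [Hq _]]. simpl in Hp, Hq.
exists (apex c), p, q. split.
{ destruct (Hc cZ) as [z [_ Hz]].
  transitivity z; [symmetry|]; apply Hz; intros x; simpl.
  - etransitivity; [symmetry; apply comp_A|]. apply f_equal, Hp.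
  - etransitivity; [symmetry; apply comp_A|].
    etransitivity; [apply f_equal, Hq|]. symmetry. apply span_comm. }
intros T u v e.
destruct (HG T) as (J & F & d & HF & Hd & HT). subst T.
pose (sec := fun j => constructive_indefinite_description _ (HF j)).
(* The map to the weak pullback from an object equal to some [G i]. *)
pose (ob := fun (X : C) (s : {i | G i = X}) (x : X ~> A) (y : X ~> B)
  (E : f ∘ x = g ∘ y) =>
  match s with exist _ i Ei =>
    match Ei in _ = X return forall (x : X ~> A) (y : X ~> B), f ∘ x = g ∘ y -> X ~> apex c
    with eq_refl => fun x y E => leg c (existT _ i (existT _ x (exist _ y E)) : span_category)
    end x y E
  end).
assert (ob_nat : forall (X X' : C) (s : {i | G i = X}) (s' : {i | G i = X'})
  (x : X ~> A) (y : X ~> B) (E : f ∘ x = g ∘ y)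
  (x' : X' ~> A) (y' : X' ~> B) (E' : f ∘ x' = g ∘ y') (h : X ~> X'),
  x' ∘ h = x -> y' ∘ h = y -> ob X' s' x' y' E' ∘ h = ob X s x y E).
{ intros X X' [i Ei] [i' Ei'] x y E x' y' E' h Hx Hy. subst X X'. simpl.
  pose (a := existT _ i (existT _ x (exist _ y E)) : span_category).
  pose (b := existT _ i' (existT _ x' (exist _ y' E')) : span_category).
  exact (leg_nat c (i := a) (j := b) (exist _ h (conj Hx Hy))). }
assert (ob_pq : forall (X : C) (s : {i | G i = X})
  (x : X ~> A) (y : X ~> B) (E : f ∘ x = g ∘ y),
  p ∘ ob X s x y E = x /\ q ∘ ob X s x y E = y).
{ intros X [i Ei] x y E. subst X. simpl. split.
  - apply (Hp (existT _ i (existT _ x (exist _ y E)))).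
  - apply (Hq (existT _ i (existT _ x (exist _ y E)))). }
assert (Ej : forall j, f ∘ (u ∘ leg d j) = g ∘ (v ∘ leg d j)).
{ intros j. rewrite !comp_A, e. reflexivity. }
unshelve epose (d' := @Cocone J C F (apex c)
  (fun j => ob (F j) (sec j) (u ∘ leg d j) (v ∘ leg d j) (Ej j)) _).
{ intros i j a. apply ob_nat.
  - rewrite <- comp_A, leg_nat. reflexivity.
  - rewrite <- comp_A, leg_nat. reflexivity. }
destruct (Hd d') as [t [Ht _]]. simpl in Ht.
exists t.
unshelve epose (dA := @Cocone J C F A (fun j => u ∘ leg d j) _).
{ intros i j a. simpl. rewrite <- comp_A, leg_nat. reflexivity. }
unshelve epose (dB := @Cocone J C F B (fun j => v ∘ leg d j) _).
{ intros i j a. simpl. rewrite <- comp_A, leg_nat. reflexivity. }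
split.
- destruct (Hd dA) as [w [_ Hw]]. transitivity w; [symmetry|]; apply Hw; intros j; simpl.
  + rewrite <- comp_A, Ht. apply ob_pq.
  + reflexivity.
- destruct (Hd dB) as [w [_ Hw]]. transitivity w; [symmetry|]; apply Hw; intros j; simpl.
  + rewrite <- comp_A, Ht. apply ob_pq.
  + reflexivity.
Qed.

(* The weak pullback becomes a pullback after coequalizing all of its
   endomorphisms. *)
Lemma pullback_exists : inhabited (pullback f g).
Proof.
destruct weak_pullback as (W & p & q & Hpq & HW).
pose (En := {h : W ~> W | p ∘ h = p /\ q ∘ h = q}).
pose (i0 := exist _ (idm W) (conj (comp_1r p) (comp_1r q)) : En).
destruct (coequalizer i0 (fun h : En => proj1_sig h) hC) as (Q & k & Hk & HQ).
destruct (HQ A p) as [p' [Hp' Up]].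
{ intros [h [h1 h2]] [l [l1 l2]]. simpl. rewrite h1, l1. reflexivity. }
destruct (HQ B q) as [q' [Hq' Uq]].
{ intros [h [h1 h2]] [l [l1 l2]]. simpl. rewrite h2, l2. reflexivity. }
assert (epi : forall (T : C) (a b : Q ~> T), a ∘ k = b ∘ k -> a = b).
{ intros T a b E. destruct (HQ T (b ∘ k)) as [r [_ Hr]].
  - intros i j. rewrite <- !comp_A. f_equal. apply Hk.
  - rewrite <- (Hr a E). apply Hr. reflexivity. }
assert (Hcomm : f ∘ p' = g ∘ q').
{ apply epi. rewrite <- !comp_A, Hp', Hq'. exact Hpq. }
assert (lift : forall (T : C) (u : T ~> A) (v : T ~> B), f ∘ u = g ∘ v ->
  {t : T ~> Q | p' ∘ t = u /\ q' ∘ t = v}).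
{ intros T u v E. apply constructive_indefinite_description.
  destruct (HW T u v E) as [t [t1 t2]]. exists (k ∘ t).
  rewrite !comp_A, Hp', Hq'. split; assumption. }
constructor.
refine (@Pullback C A B Z f g Q p' q' Hcomm
  (fun T u v E => proj1_sig (lift T u v E)) _ _ _).
- intros T u v E. apply (proj2_sig (lift T u v E)).
- intros T u v E. apply (proj2_sig (lift T u v E)).
- intros T a b Ea Eb.
  destruct (coequalizer true (fun x : bool => if x then a else b) hC)
    as (R & r & Hr & HR).
  destruct (HR A p') as [pR [HpR _]].
  { intros [] []; congruence. }
  destruct (HR B q') as [qR [HqR _]].
  { intros [] []; congruence. }
  assert (HRc : f ∘ pR = g ∘ qR).
  { destruct (HR Z (f ∘ p')) as [w [_ Hw]].
    { intros [] []; rewrite <- ?comp_A; congruence. }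
    transitivity w; [symmetry|]; apply Hw.
    - rewrite <- comp_A, HpR. reflexivity.
    - rewrite <- comp_A, HqR. symmetry. exact Hcomm. }
  destruct (HW R pR qR HRc) as [w [w1 w2]].
  assert (Hw : p ∘ (w ∘ r ∘ k) = p /\ q ∘ (w ∘ r ∘ k) = q).
  { rewrite !comp_A, w1, w2, HpR, HqR. split; assumption. }
  assert (Hs : k ∘ w ∘ r = idm Q).
  { apply epi. rewrite comp_1l.
    pose proof (Hk (exist _ _ Hw) i0) as H. simpl in H.
    rewrite comp_1r, !comp_A in H. exact H. }
  rewrite <- (comp_1l a), <- (comp_1l b), <- Hs, <- !(comp_A (k ∘ w)).
  f_equal. exact (Hr true false).
Qed.

End Pullbacks.

Theorem locally_presentable_pullbacks (C : category) :
  locally_presentable C -> inhabited (pullbacks C).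
Proof.
intros (K & _ & hC & I & G & _ & HG).
constructor. intros A B Z f g.
assert (H : exists _ : pullback f g, True).
{ destruct (@pullback_exists C hC I G) with (f := f) (g := g) as [x].
  - intros X. destruct (HG X) as (J & F & c & _ & H). exists J, F, c. exact H.
  - exists x. exact Logic.I. }
exact (proj1_sig (constructive_indefinite_description _ H)).
Qed.

(* Main.v *)
Require Import Defs.
From Stdlib Require Import FunctionalExtensionality PropExtensionality ProofIrrelevance.
From Stdlib Require Import ClassicalEpsilon.

Set Implicit Arguments.
Unset Strict Implicit.
Unset Printing Implicit Defensive.

(** In a locally presentable category, an object of a slice is again a filtered
    colimit of presentable objects, namely of maps from generators, so that all
    slices are of the same kind ([slice_generated]). The two adjoints are then two
    cases of one statement about a category [E] that is cocomplete, has finite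
    products and has a small set [G] of presentable objects of which every object
    is a filtered colimit. Fix an object [A] of [E], and select some maps
    [A ~> ab_carrier M], for [M] ranging over the abelian group objects. If the
    selection is reflected by jointly monic families of homomorphisms, then there
    is a universal selected map ([universal_ab_object]).

    For the free abelian group object on [A], all maps are selected. For a functor
    [F : E -> E'] which preserves finite products and has universal arrows
    [eta : B ~> F A], as a pullback functor between slices does, the homomorphisms
    from an abelian group object on [B] to the image of [M] correspond to the maps
    [a : A ~> M] for which [fmap F a ∘ eta] is additive, and these are selected
    ([ab_functor_left_adjoint]).

    The universal selected map comes from the adjoint functor theorem, which needs
    limits and a solution set.

    - Limits. The cones with vertex in [G] over a small diagram form a small
      category. The colimit of their vertices carries a cone through which every
      cone factors, as every object is a colimit of generators. Coequalizing the
      endomorphisms of this cone makes the factorization unique ([graph_limit]).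
      Maps into a limit inherit the operations of the hom-groups, so the limit of
      abelian group objects is one ([ab_graph_limit]).

    - Solution set. Given [a : A ~> M], a downward Löwenheim-Skolem argument yields
      a set of maps from generators to [M] which contains the maps [a ∘ g], whose
      span is closed under the group operations, and which is a filtered
      subcategory of the category of all such maps. Filteredness and
      presentability make its colimit a subobject of [M], a subgroup object through
      which [a] factors ([small_subobject]). The elements of the set are the
      values of well-founded expressions, built with [K]-ary nodes for the regular
      cardinal [K]. The type of these expressions does not depend on [M], and
      bounds the size of the set without cardinal arithmetic ([skolem_hull]). So
      all subobjects that occur are colimits of diagrams on one and the same small
      type of objects, and there is only a small set of them ([solution_set]).

    The limit of the small full subcategory of selected maps from the solution set
    is universal: it is weakly so by construction, and uniqueness of the
    factorization follows by mapping to the equalizer of two candidates. *)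

(** * Choice *)

Lemma dependent_choice (A : Type) (B : A -> Type) (R : forall a, B a -> Prop) :
  (forall a, exists b, R a b) -> exists f : forall a, B a, forall a, R a (f a).
Proof.
intros H. exists (fun a => proj1_sig (constructive_indefinite_description _ (H a))).
intros a. apply proj2_sig.
Qed.

(** * Cardinals *)

Lemma card_le_trans (A B D : Small) : card_le A B -> card_le B D -> card_le A D.
Proof. intros [f Hf] [g Hg]. exists (fun x => g (f x)). auto. Qed.

Lemma card_le_lt_trans (A B K : Small) : card_le A B -> card_lt B K -> card_lt A K.
Proof.
intros HAB [HBK HKB]. split.
- exact (card_le_trans HAB HBK).
- intros HKA. exact (HKB (card_le_trans HKA HAB)).
Qed.

(** This turns families indexed by a small cardinal into families indexed by [K]
    with the same members, so that expressions can branch over [K] alone. *)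
Lemma card_le_surjection (A K : Small) (a0 : A) :
  card_le A K -> exists r : K -> A, forall a, exists k, r k = a.
Proof.
intros [f Hf].
destruct (dependent_choice (A := K) (B := fun _ => A)
  (R := fun k a => forall a', f a' = k -> a' = a)) as [r Hr].
{ intros k. destruct (classic (exists a, f a = k)) as [[a <-]|N].
  - exists a. intros a'. apply Hf.
  - exists a0. intros a' Ha'. destruct N. eauto. }
exists r. intros a. exists (f a). symmetry. apply Hr. reflexivity.
Qed.

Lemma card_lt_bool (K : Small) : regular_cardinal K -> card_lt bool K.
Proof.
intros [HK _]. split.
- apply card_le_trans with nat; [|exact HK].
  exists (fun b : bool => if b then 1 else 0). intros [] []; congruence.
- intros H. destruct (card_le_trans HK H) as [f Hf].
  assert (f 0 <> f 1) by (intros e; discriminate (Hf _ _ e)).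
  assert (f 0 <> f 2) by (intros e; discriminate (Hf _ _ e)).
  assert (f 1 <> f 2) by (intros e; discriminate (Hf _ _ e)).
  destruct (f 0), (f 1), (f 2); congruence.
Qed.

Lemma card_lt_empty (K : Small) : regular_cardinal K -> card_lt Empty_set K.
Proof.
intros HK. apply card_le_lt_trans with bool; [|exact (card_lt_bool HK)].
exists (fun e : Empty_set => match e with end). intros [].
Qed.

(** * Filtered categories *)

(** The cocones over all small diagrams of size less than [K] reduce to two cases:
    discrete diagrams, and families of parallel maps. *)
Definition has_bounds (K : Small) (J : category) : Prop :=
  forall (A : Small) (x : A -> J), card_lt A K ->
    exists y, inhabited (forall a, x a ~> y).

Definition has_coequalizing_maps (K : Small) (J : category) : Prop :=
  forall (A : Small) (x y : J) (p : A -> (x ~> y)), card_lt A K ->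
    exists (z : J) (w : y ~> z), forall a b, w ∘ p a = w ∘ p b.

Section Filtered.
Context (K : Small) (HK : regular_cardinal K).

Definition discrete (A : Small) : small_category.
Proof.
unshelve refine (@SmallCategory A (@CategoryOn A (fun x y => x = y) _ _ _ _ _)).
- intros x. reflexivity.
- intros x y z e e'. exact (eq_trans e' e).
- intros. apply proof_irrelevance.
- intros. apply proof_irrelevance.
- intros. apply proof_irrelevance.
Defined.

Definition discrete_functor (A : Small) (J : category) (x : A -> J) :
  functor (discrete A) J.
Proof.
unshelve refine (@Functor (discrete A) J x _ _ _).
- intros a b e. exact (match e in _ = c return x a ~> x c with eq_refl => idm (x a) end).
- intros a. reflexivity.
- intros a b c e e'. destruct e, e'. symmetry. apply comp_1l.
Defined.

Lemma filtered_bounds (J : small_category) : filtered K J -> has_bounds K J.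
Proof.
intros HJ A x HA.
destruct (HJ (discrete A) (discrete_functor x)) as [c].
- apply card_le_lt_trans with A; [|exact HA].
  exists (fun m : arrows (discrete A) => projT1 m).
  intros [a [b e]] [a' [b' e']]. cbn in *. destruct e, e'. intros ->. reflexivity.
- exists (apex c). constructor. exact (leg c).
Qed.

(** Besides [A], there are two identities; [A] and a two-element type have a sum
    below [K] by regularity. *)
Lemma arrows_parallel (A : Small) : card_lt A K -> card_lt (arrows (parallel A)) K.
Proof.
intros HA.
apply card_le_lt_trans with {b : bool & if b then A else bool}.
- exists (fun m : arrows (parallel A) =>
    match m with
    | existT _ false (existT _ true i) => existT (fun b : bool => if b then A else bool) true i
    | existT _ b _ => existT (fun b : bool => if b then A else bool) false b
    end).
  intros [[] [[] f]] [[] [[] g]] H; cbn in *; try destruct f; try destruct g;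
    try reflexivity.
  all: pose (pr := fun (s : {b : bool & if b then A else bool}) => match s with
    | existT _ true i => inl i | existT _ false b => inr b end).
  all: apply (f_equal pr) in H; cbn in H; congruence.
- apply (proj2 HK); [exact (card_lt_bool HK)|].
  intros []; [exact HA | exact (card_lt_bool HK)].
Qed.

Lemma filtered_coequalizing (J : small_category) :
  filtered K J -> has_coequalizing_maps K J.
Proof.
intros HJ A x y p HA.
destruct (HJ (parallel A) (parallel_functor p) (arrows_parallel HA)) as [c].
exists (apex c), (leg c true). intros a b.
transitivity (leg c false).
- exact (leg_nat c (i := false) (j := true) a).
- symmetry. exact (leg_nat c (i := false) (j := true) b).
Qed.

(** Bound all objects of the diagram, repair each triangle separately, bound the
    results, and finally make the repairing maps equal to each other. *)
Lemma filtered_of_bounds (J : small_category) :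
  has_bounds K J -> has_coequalizing_maps K J -> filtered K J.
Proof.
intros HB HC S F HS.
assert (HO : card_lt (small_obj S) K).
{ apply card_le_lt_trans with (arrows S); [|exact HS].
  exists (fun s => existT _ s (existT _ s (id_on (small_cat_on S) s))).
  intros s t e. exact (f_equal (@projT1 _ _) e). }
destruct (HB (small_obj S) (fun s => F s) HO) as [y [u]].
destruct (classic (inhabited (small_obj S))) as [[s0]|HS0]; cycle 1.
{ constructor. unshelve refine (@Cocone S J F y u _).
  intros i j a. destruct HS0. constructor. exact i. }
(* One map out of [y] for every arrow, making its triangle commute. *)
pose (src := fun a : arrows S => projT1 a : S).
pose (tgt := fun a : arrows S => projT1 (projT2 a) : S).
pose (arr := fun a : arrows S => projT2 (projT2 a) : src a ~> tgt a).
destruct (dependent_choice (A := arrows S) (B := fun _ => {z : J & y ~> z})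
  (R := fun a s => projT2 s ∘ (u (tgt a) ∘ fmap F (arr a)) = projT2 s ∘ u (src a)))
  as [w Hw].
{ intros a.
  destruct (HC bool (F (src a)) y
    (fun b => if b then u (tgt a) ∘ fmap F (arr a) else u (src a)) (card_lt_bool HK))
    as (z & w & Hw).
  exists (existT _ z w). exact (Hw true false). }
destruct (HB (arrows S) (fun a => projT1 (w a)) HS) as [y' [v]].
destruct (HC (arrows S) y y' (fun a => v a ∘ projT2 (w a)) HS) as (z & t & Ht).
pose (a0 := existT _ s0 (existT _ s0 (id_on (small_cat_on S) s0)) : arrows S).
pose (q := t ∘ (v a0 ∘ projT2 (w a0))).
assert (Hq : forall a, q ∘ (u (tgt a) ∘ fmap F (arr a)) = q ∘ u (src a)).
{ intros a. unfold q. rewrite (Ht a0 a), <- !(comp_A t), <- !(comp_A (v a)), Hw.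
  reflexivity. }
constructor. unshelve refine (@Cocone S J F z (fun s => q ∘ u s) _).
intros i j f. rewrite <- comp_A. exact (Hq (existT _ i (existT _ j f))).
Qed.

End Filtered.

(** * Presentable objects *)

(** The elementary form of presentability: maps from [G] to a filtered colimit
    factor through a stage, in an essentially unique way. *)
Definition compact (K : Small) (E : category) (G : E) : Prop :=
  forall (J : small_category) (F : functor J E) (c : cocone F),
    filtered K J -> is_colimit c ->
    (forall g : G ~> apex c, exists (j : J) (h : G ~> F j), leg c j ∘ h = g) /\
    (forall (j : J) (x y : G ~> F j), leg c j ∘ x = leg c j ∘ y ->
      exists (k : J) (a : j ~> k), fmap F a ∘ x = fmap F a ∘ y).

Lemma bounds2 (K : Small) (J : category) (x y : J) :
  regular_cardinal K -> has_bounds K J ->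
  exists z, inhabited ((x ~> z) * (y ~> z)).
Proof.
intros HK HB.
destruct (HB bool (fun b => if b then x else y) (card_lt_bool HK)) as [z [u]].
exists z. constructor. exact (u true, u false).
Qed.

Lemma coequalizing2 (K : Small) (J : category) (x y : J) (p q : x ~> y) :
  regular_cardinal K -> has_coequalizing_maps K J ->
  exists (z : J) (w : y ~> z), w ∘ p = w ∘ q.
Proof.
intros HK HC.
destruct (HC bool x y (fun b => if b then p else q) (card_lt_bool HK)) as (z & w & Hw).
exists z, w. exact (Hw true false).
Qed.

Lemma colimit_eq (J E : category) (F : functor J E) (c : cocone F) (T : E)
  (u v : apex c ~> T) :
  is_colimit c -> (forall j, u ∘ leg c j = v ∘ leg c j) -> u = v.
Proof.
intros Hc H.
unshelve epose (c' := @Cocone J E F T (fun j => v ∘ leg c j) _).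
{ intros i j a. cbn. rewrite <- comp_A, leg_nat. reflexivity. }
destruct (Hc c') as [w [_ Hw]]. transitivity w; [symmetry|]; apply Hw; cbn.
- exact H.
- reflexivity.
Qed.

(** Both properties are read off from the colimit of sets of maps from [G], by
    comparing two maps to [Prop] for the first, and by mapping to the set of
    equivalence classes for the second. *)
Lemma presentable_compact (K : Small) (E : category) (G : E) :
  regular_cardinal K -> presentable K G -> compact K G.
Proof.
intros HK HG J F c HJ Hc. pose proof (HG J F c HJ Hc) as H.
pose proof (filtered_bounds HJ) as HB.
pose proof (filtered_coequalizing HK HJ) as HC.
split.
- pose (u := (fun g => exists (j : J) (h : G ~> F j), leg c j ∘ h = g)
    : hom (C := sets) (G ~> apex c) (Prop : Small)).
  pose (v := (fun g => True) : hom (C := sets) (G ~> apex c) (Prop : Small)).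
  assert (e : u = v).
  { apply (colimit_eq (c := map_cocone (hom_functor G) c) H).
    intros j. apply functional_extensionality. intros h.
    apply propositional_extensionality. split; [constructor|].
    intros _. exists j, h. reflexivity. }
  intros g. change (u g). rewrite e. constructor.
- pose (El := {j : small_obj J & G ~> F j} : Small).
  pose (R := fun (s t : El) => exists (k : J)
    (a : hom (C := J) (projT1 s) k) (b : hom (C := J) (projT1 t) k),
    fmap F a ∘ projT2 s = fmap F b ∘ projT2 t).
  (* The cocone whose leg at [j] sends a map to its class in the colimit of the
     sets of maps [G ~> F j]. *)
  unshelve epose (d := @Cocone J sets (functor_comp (hom_functor G) F)
    ((El -> Prop) : Small) (fun j (x : G ~> F j) => R (existT _ j x)) _).
  { intros i j a. apply functional_extensionality. intros x.
    apply functional_extensionality. intros [s y].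
    apply propositional_extensionality. unfold R. cbn. split.
    - intros (k & u & v & e). exists k, (u ∘ a), v.
      rewrite fmap_comp, <- comp_A. exact e.
    - intros (k & u & v & e).
      destruct (bounds2 j k HK HB) as [l [[p q]]].
      destruct (coequalizing2 (p ∘ a) (q ∘ u) HK HC) as (z & w & Hw).
      exists z, (w ∘ p), (w ∘ (q ∘ v)).
      rewrite comp_A, <- fmap_comp, <- comp_A, Hw.
      rewrite !fmap_comp, <- !comp_A, e. reflexivity. }
  destruct (H d) as [h [Hh _]].
  intros j x y e.
  assert (Rxy : R (existT _ j x) (existT _ j y)).
  { assert (Ej : forall z : G ~> F j, h (leg c j ∘ z) = R (existT _ j z)).
    { intros z. exact (f_equal (fun f => f z) (Hh j)). }
    rewrite <- Ej, e, Ej.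
    exists j, (idm j), (idm j). reflexivity. }
  destruct Rxy as (k & a & b & Eab). cbn in a, b, Eab.
  destruct (coequalizing2 a b HK HC) as (z & w & Hw).
  exists z, (w ∘ a). rewrite Hw at 2. rewrite !fmap_comp, <- !comp_A, Eab. reflexivity.
Qed.

(** * Categories generated by a set of presentable objects *)

Definition generated (K : Small) (E : category) (I : Small) (G : I -> E) : Prop :=
  (forall i, compact K (G i)) /\
  forall X : E, exists (J : small_category) (F : functor J E) (c : cocone F),
    filtered K J /\ (forall j : J, exists i, G i = F j) /\ is_colimit c /\ apex c = X.

Section Generated.
Context (K : Small) (HK : regular_cardinal K).
Context (E : category) (I : Small) (G : I -> E) (HG : generated K G).

Lemma generated_eq (T W : E) (u v : T ~> W) :
  (forall i (g : G i ~> T), u ∘ g = v ∘ g) -> u = v.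
Proof.
intros H. destruct (proj2 HG T) as (J & F & c & _ & HF & Hc & HT). subst T.
apply (colimit_eq Hc). intros j. destruct (HF j) as [i Hi].
revert H. generalize (leg c j). destruct Hi. intros l H. apply H.
Qed.

(** Density of the generators: as every map from a generator to [T] factors
    through a leg of the given colimit, the legs determine everything. *)
Lemma generated_dense (T W : E) (phi : forall i, (G i ~> T) -> (G i ~> W)) :
  (forall i j (h : G i ~> G j) (g : G j ~> T), phi i (g ∘ h) = phi j g ∘ h) ->
  exists t : T ~> W, forall i (g : G i ~> T), t ∘ g = phi i g.
Proof.
intros Hphi. destruct (proj2 HG T) as (J & F & c & HJ & HF & Hc & HT). subst T.
destruct (dependent_choice (A := J) (B := fun j => F j ~> W)
  (R := fun j t => forall i (h : G i ~> F j), t ∘ h = phi i (leg c j ∘ h))) as [t Ht].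
{ intros j. generalize (leg c j). destruct (HF j) as [k Hk]. destruct Hk. intros l.
  exists (phi k l). intros i h. symmetry. apply Hphi. }
unshelve epose (d := @Cocone J E F W t _).
{ intros i j a. apply generated_eq. intros k g.
  rewrite <- comp_A, !Ht, comp_A, leg_nat. reflexivity. }
destruct (Hc d) as [u [Hu _]]. exists u. intros i g.
destruct (proj1 (proj1 HG i J F c HJ Hc) g) as (j & h & <-).
rewrite comp_A, Hu. apply Ht.
Qed.

(** With the next lemma: the category of maps from generators to [M] has bounds
    and coequalizing maps, because [M] is a filtered colimit of generators. *)
Lemma generated_bounds (M : E) (A : Small) (i : A -> I) (n : forall a, G (i a) ~> M) :
  card_lt A K ->
  exists (k : I) (m : G k ~> M), forall a, exists u : G (i a) ~> G k, m ∘ u = n a.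
Proof.
intros HA. destruct (proj2 HG M) as (J & F & c & HJ & HF & Hc & HM). subst M.
destruct (dependent_choice (A := A) (B := fun a => {j : J & G (i a) ~> F j})
  (R := fun a s => leg c (projT1 s) ∘ projT2 s = n a)) as [s Hs].
{ intros a. destruct (proj1 (proj1 HG (i a) J F c HJ Hc) (n a)) as (j & h & e).
  exists (existT _ j h). exact e. }
destruct (filtered_bounds HJ (fun a => projT1 (s a)) HA) as [j [v]].
assert (H : forall a, exists u : G (i a) ~> F j, leg c j ∘ u = n a).
{ intros a. exists (fmap F (v a) ∘ projT2 (s a)).
  rewrite comp_A, leg_nat. apply Hs. }
revert H. generalize (leg c j). destruct (HF j) as [k Hk]. destruct Hk.
intros m H. exists k, m. exact H.
Qed.

Lemma generated_coequalizing (M : E) (A : Small) (i k : I) (p : A -> (G i ~> G k))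
  (m : G k ~> M) :
  card_lt A K -> (forall a b, m ∘ p a = m ∘ p b) ->
  exists (l : I) (m' : G l ~> M) (w : G k ~> G l),
    m' ∘ w = m /\ forall a b, w ∘ p a = w ∘ p b.
Proof.
intros HA Hm.
destruct (classic (inhabited A)) as [[a0]|HA0]; cycle 1.
{ exists k, m, (idm _). split; [apply comp_1r|].
  intros a. destruct HA0. constructor. exact a. }
destruct (proj2 HG M) as (J & F & c & HJ & HF & Hc & HM). subst M.
destruct (proj1 (proj1 HG k J F c HJ Hc) m) as (j & h & <-).
destruct (dependent_choice (A := A) (B := fun a => {j' : J & j ~> j'})
  (R := fun a s => fmap F (projT2 s) ∘ (h ∘ p a) = fmap F (projT2 s) ∘ (h ∘ p a0)))
  as [s Hs].
{ intros a. destruct (proj2 (proj1 HG i J F c HJ Hc) j (h ∘ p a) (h ∘ p a0))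
    as (j' & v & e).
  - rewrite !comp_A. apply Hm.
  - exists (existT _ j' v). exact e. }
destruct (filtered_bounds HJ (fun a => projT1 (s a)) HA) as [j' [v]].
destruct (filtered_coequalizing HK HJ (fun a => v a ∘ projT2 (s a)) HA) as (l & z & Hz).
assert (H : exists w : G k ~> F l, leg c l ∘ w = leg c j ∘ h /\
  forall a b, w ∘ p a = w ∘ p b).
{ exists (fmap F (z ∘ (v a0 ∘ projT2 (s a0))) ∘ h). split.
  - rewrite comp_A, leg_nat. reflexivity.
  - assert (H0 : forall a, fmap F (z ∘ (v a0 ∘ projT2 (s a0))) ∘ h ∘ p a =
                           fmap F (z ∘ (v a0 ∘ projT2 (s a0))) ∘ h ∘ p a0).
    { intros a. rewrite (Hz a0 a), <- !comp_A, !fmap_comp, <- !comp_A, Hs. reflexivity. }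
    intros a b. rewrite (H0 a), (H0 b). reflexivity. }
revert H. generalize (leg c l). destruct (HF l) as [l' Hl]. destruct Hl.
intros m' [w H]. exists l', m', w. exact H.
Qed.

End Generated.

(** * Slices *)

Section Slices.
Context (C : category) (X : C).

Definition slice_forget : functor (slice X) C.
Proof.
refine (@Functor (slice X) C (@s_dom C X) (fun A B (f : slice_hom A B) => s_map f) _ _).
- intros A. reflexivity.
- intros A B D g f. reflexivity.
Defined.

Definition slice_cocone (J : category) (F : functor J (slice X))
  (d : cocone (functor_comp slice_forget F)) (a : apex d ~> X)
  (Ha : forall j, a ∘ leg d j = s_arr (F j : slice_obj X)) : cocone F.
Proof.
refine (@Cocone J (slice X) F (SliceObj a)
  (fun j => @SliceHom C X _ (SliceObj a) (leg d j) (Ha j)) _).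
intros i j f. apply slice_hom_eq. exact (leg_nat d f).
Defined.

Lemma slice_cocone_colimit (J : category) (F : functor J (slice X))
  (d : cocone (functor_comp slice_forget F)) (a : apex d ~> X)
  (Ha : forall j, a ∘ leg d j = s_arr (F j : slice_obj X)) :
  is_colimit d -> is_colimit (slice_cocone Ha).
Proof.
intros Hd c'.
destruct (Hd (map_cocone slice_forget c')) as [h [Hh Uh]].
assert (e : s_arr (apex c' : slice_obj X) ∘ h = a).
{ apply (colimit_eq Hd). intros j.
  rewrite <- comp_A, Hh, Ha. apply (s_map_comm (leg c' j : slice_hom _ _)). }
exists (@SliceHom C X (SliceObj a) (apex c') h e). split.
- intros j. apply slice_hom_eq. apply Hh.
- intros k Hk. apply slice_hom_eq. apply Uh. intros j.
  exact (f_equal (@s_map C X _ _) (Hk j)).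
Qed.

Lemma slice_colimit (J : small_category) (F : functor J (slice X)) :
  cocomplete C ->
  exists (d : cocone (functor_comp slice_forget F)) (a : apex d ~> X)
    (Ha : forall j, a ∘ leg d j = s_arr (F j : slice_obj X)), is_colimit d.
Proof.
intros hC. destruct (hC J (functor_comp slice_forget F)) as [d Hd].
unshelve epose (b := @Cocone J C (functor_comp slice_forget F) X
  (fun j => s_arr (F j : slice_obj X)) _).
{ intros i j f. apply (s_map_comm (fmap F f : slice_hom _ _)). }
destruct (Hd b) as [a [Ha _]]. exists d, a, Ha. exact Hd.
Qed.

Lemma slice_cocomplete : cocomplete C -> cocomplete (slice X).
Proof.
intros hC J F. destruct (slice_colimit F hC) as (d & a & Ha & Hd).
exists (slice_cocone Ha). apply slice_cocone_colimit, Hd.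
Qed.

(** A colimit in the slice is compared with the colimit of the domains, where the
    compactness of [G] applies. *)
Lemma slice_compact (K : Small) (G : C) (g : G ~> X) :
  cocomplete C -> compact K G -> compact K (E := slice X) (SliceObj g).
Proof.
intros hC HG J F c HJ Hc.
destruct (slice_colimit F hC) as (d & a & Ha & Hd).
destruct (Hc (slice_cocone Ha)) as [h [Hh _]].
destruct (slice_cocone_colimit Ha Hd c) as [h' [Hh' _]].
assert (e : h' ∘ h = idm (apex c)).
{ apply (colimit_eq Hc). intros j. rewrite <- comp_A, Hh, Hh', comp_1l. reflexivity. }
destruct (HG J _ d HJ Hd) as [HE HU]. split.
- intros x.
  destruct (HE (s_map (h ∘ x : slice_hom _ _))) as (j & y & Hy).
  assert (Ey : s_arr (F j : slice_obj X) ∘ y = g).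
  { rewrite <- Ha, <- comp_A, Hy. apply (s_map_comm (h ∘ x : slice_hom _ _)). }
  exists j, (@SliceHom C X (SliceObj g) (F j) y Ey).
  rewrite <- (comp_1l x), <- e, <- Hh', <- !comp_A.
  f_equal. apply slice_hom_eq. exact Hy.
- intros j x y Exy.
  destruct (HU j (s_map (x : slice_hom _ _)) (s_map (y : slice_hom _ _))) as (k & f & Hf).
  + pose proof (f_equal (fun z => h ∘ z) Exy) as H. cbn beta in H.
    rewrite !comp_A, Hh in H. exact (f_equal (@s_map C X _ _) H).
  + exists k, f. apply slice_hom_eq. exact Hf.
Qed.

(** The diagram which presents the domain of an object over [X] also presents
    the object. *)
Lemma slice_generated (K : Small) (I : Small) (G : I -> C) :
  cocomplete C -> generated K G ->
  generated K (E := slice X) (fun s : {i : I & G i ~> X} => SliceObj (projT2 s)).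
Proof.
intros hC [HG HD]. split.
- intros [i g]. apply slice_compact; auto.
- intros [D x]. destruct (HD D) as (J & F & c & HJ & HF & Hc & HA). subst D.
  unshelve epose (F' := @Functor J (slice X) (fun j => SliceObj (x ∘ leg c j))
    (fun i j f => @SliceHom C X (SliceObj _) (SliceObj _) (fmap F f) _) _ _).
  { cbn. rewrite <- comp_A, leg_nat. reflexivity. }
  { intros j. apply slice_hom_eq. apply (fmap_id F). }
  { intros i j k g f. apply slice_hom_eq. apply (fmap_comp F). }
  unshelve epose (d := @Cocone J C (functor_comp slice_forget F') (apex c) (leg c) _).
  { intros i j f. exact (leg_nat c f). }
  assert (Hd : is_colimit d).
  { intros c'. unshelve epose (c2 := @Cocone J C F (apex c') (leg c') _).
    { intros i j f. exact (leg_nat c' f). }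
    exact (Hc c2). }
  exists J, F', (slice_cocone (d := d) (a := x) (fun j => eq_refl)).
  split; [exact HJ|]. split; [|split; [apply slice_cocone_colimit, Hd | reflexivity]].
  intros j. cbn. destruct (HF j) as [i Hi].
  generalize (x ∘ leg c j). destruct Hi. intros y. exists (existT _ i y). reflexivity.
Qed.

End Slices.

(** * Limits *)

Definition jointly_monic (E : category) (V : Type) (B : V -> E) (L : E)
  (p : forall v, L ~> B v) : Prop :=
  forall (T : E) (x y : T ~> L), (forall v, p v ∘ x = p v ∘ y) -> x = y.

Section Limits.
Context (E : category) (V : Small) (B : V -> E) (Q : V -> V -> Small)
  (f : forall v v', Q v v' -> (B v ~> B v')).

(** The diagrams are graphs of maps, without any composition, which suffices for
    products and equalizers alike. *)
Definition graph_cone (T : E) (s : forall v, T ~> B v) : Prop :=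
  forall v v' (q : Q v v'), f q ∘ s v = s v'.

Lemma graph_cone_comp (T S : E) (s : forall v, T ~> B v) (u : S ~> T) :
  graph_cone s -> graph_cone (fun v => s v ∘ u).
Proof. intros Hs v v' q. rewrite comp_A, Hs. reflexivity. Qed.

Lemma graph_limit_jointly_monic (L : E) (p : forall v, L ~> B v) :
  graph_cone p ->
  (forall (T : E) (s : forall v, T ~> B v), graph_cone s ->
    exists! t : T ~> L, forall v, p v ∘ t = s v) ->
  jointly_monic p.
Proof.
intros Hp HL T x y e. destruct (HL T (fun v => p v ∘ y)) as [t [_ Ht]].
- apply graph_cone_comp, Hp.
- transitivity t; [symmetry|]; apply Ht; [exact e | reflexivity].
Qed.

Context (K : Small) (I : Small) (G : I -> E) (HG : generated K G)
  (hE : cocomplete E).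

Definition cone_obj : Small :=
  {i : I & {s : forall v, G i ~> B v | graph_cone s}}.
Definition cone_at (x : cone_obj) : forall v, G (projT1 x) ~> B v :=
  proj1_sig (projT2 x).

Definition cone_hom (x y : cone_obj) : Small :=
  {h : G (projT1 x) ~> G (projT1 y) | forall v, cone_at y v ∘ h = cone_at x v}.

Lemma cone_hom_eq (x y : cone_obj) (h k : cone_hom x y) :
  proj1_sig h = proj1_sig k -> h = k.
Proof.
destruct h as [h Hh], k as [k Hk]. cbn. intros ->. f_equal. apply proof_irrelevance.
Qed.

Definition cone_id (x : cone_obj) : cone_hom x x :=
  exist (fun h => forall v, cone_at x v ∘ h = cone_at x v)
    (idm (G (projT1 x))) (fun v => comp_1r (cone_at x v)).

Definition cone_comp (x y z : cone_obj) (k : cone_hom y z) (h : cone_hom x y) :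
  cone_hom x z.
Proof.
exists (proj1_sig k ∘ proj1_sig h).
intros v. rewrite comp_A, (proj2_sig k). apply (proj2_sig h).
Defined.

Definition cone_category : small_category.
Proof.
refine (@SmallCategory cone_obj (@CategoryOn cone_obj cone_hom cone_id cone_comp _ _ _)).
- intros x y h. apply cone_hom_eq, comp_1l.
- intros x y h. apply cone_hom_eq, comp_1r.
- intros x y z w h k l. apply cone_hom_eq, comp_A.
Defined.

Definition cone_functor : functor cone_category E :=
  @Functor cone_category E (fun x : cone_obj => G (projT1 x))
    (fun x y (h : cone_hom x y) => proj1_sig h)
    (fun x => eq_refl) (fun x y z k h => eq_refl).

Lemma weak_graph_limit :
  exists (W : E) (p : forall v, W ~> B v), graph_cone p /\
    forall (T : E) (s : forall v, T ~> B v), graph_cone s ->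
      exists t : T ~> W, forall v, p v ∘ t = s v.
Proof.
destruct (hE cone_functor) as [c Hc].
destruct (dependent_choice (A := V) (B := fun v => apex c ~> B v)
  (R := fun v p => forall x : cone_obj, p ∘ leg c x = cone_at x v)) as [p Hp].
{ intros v.
  unshelve epose (d := @Cocone cone_category E cone_functor (B v)
    (fun x : cone_obj => cone_at x v) _).
  { intros x y h. exact (proj2_sig h v). }
  destruct (Hc d) as [p [Hp _]]. exists p. exact Hp. }
exists (apex c), p. split.
- intros v v' q. apply (colimit_eq Hc). intros x.
  rewrite <- comp_A, !Hp. apply (proj2_sig (projT2 x)).
- intros T s Hs.
  destruct (generated_dense HG (T := T) (W := apex c) (phi := fun i g =>
    leg c (existT _ i (exist _ (fun v => s v ∘ g) (graph_cone_comp g Hs)) : cone_obj)))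
    as [t Ht].
  { intros i j h g. symmetry.
    unshelve refine (leg_nat c (i := existT _ i (exist _ _ _) : cone_obj)
      (j := existT _ j (exist _ _ _) : cone_obj) (exist _ h _)).
    intros v. symmetry. apply comp_A. }
  exists t. intros v. apply (generated_eq HG). intros i g.
  rewrite <- comp_A, Ht.
  exact (Hp v (existT _ i (exist _ (fun v => s v ∘ g) (graph_cone_comp g Hs)))).
Qed.

(** The quotient [k : W ~> L] of the weak limit by all its endomorphisms still
    classifies cones. If two maps [a, b] to [L] induce the same cone, then this cone
    descends to their coequalizer [r], hence is classified by a map [w] from there
    to [W]. As [k] coequalizes the endomorphism [w ∘ r ∘ k] of [W] and the identity,
    [k ∘ w] is a retraction of [r], and [a = b]. *)
Lemma graph_limit :
  exists (L : E) (p : forall v, L ~> B v), graph_cone p /\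
    forall (T : E) (s : forall v, T ~> B v), graph_cone s ->
      exists! t : T ~> L, forall v, p v ∘ t = s v.
Proof.
destruct weak_graph_limit as (W & p & Hp & HW).
pose (En := {h : W ~> W | forall v, p v ∘ h = p v}).
pose (i0 := exist (fun h => forall v, p v ∘ h = p v) (idm W) (fun v => comp_1r (p v)) : En).
destruct (coequalizer i0 (fun h : En => proj1_sig h) hE) as (L & k & Hk & HL).
assert (epi : forall (T : E) (a b : L ~> T), a ∘ k = b ∘ k -> a = b).
{ intros T a b e. destruct (HL T (b ∘ k)) as [r [_ Hr]].
  - intros i j. rewrite <- !comp_A. f_equal. apply Hk.
  - rewrite <- (Hr a e). apply Hr. reflexivity. }
destruct (dependent_choice (A := V) (B := fun v => L ~> B v)
  (R := fun v p' => p' ∘ k = p v)) as [p' Hp'].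
{ intros v. destruct (HL (B v) (p v)) as [r [Hr _]].
  - intros [h Hh] [l Hl]. cbn. rewrite Hh, Hl. reflexivity.
  - exists r. exact Hr. }
exists L, p'. split.
{ intros v v' q. apply epi. rewrite <- comp_A, !Hp'. apply Hp. }
intros T s Hs. destruct (HW T s Hs) as [t Ht].
exists (k ∘ t). split.
{ intros v. rewrite comp_A, Hp'. apply Ht. }
intros a Ha. set (b := k ∘ t).
assert (Hab : forall v, p' v ∘ a = p' v ∘ b).
{ intros v. rewrite Ha. unfold b. rewrite comp_A, Hp', Ht. reflexivity. }
clearbody b. clear s Hs t Ht Ha. symmetry.
destruct (coequalizer true (fun x : bool => if x then a else b) hE) as (R & r & Hr & HR).
destruct (dependent_choice (A := V) (B := fun v => R ~> B v)
  (R := fun v pR => pR ∘ r = p' v)) as [pR HpR].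
{ intros v. destruct (HR (B v) (p' v)) as [z [Hz _]].
  - intros [] []; rewrite ?Hab; reflexivity.
  - exists z. exact Hz. }
assert (HRc : graph_cone pR).
{ intros v v' q. destruct (HR (B v') (p' v')) as [w [_ Hw]].
  { intros [] []; rewrite ?Hab; reflexivity. }
  transitivity w; [symmetry|]; apply Hw; [|apply HpR].
  rewrite <- comp_A, HpR. apply epi. rewrite <- comp_A, !Hp'. apply Hp. }
destruct (HW R pR HRc) as [w Hw].
assert (Hwk : forall v, p v ∘ (w ∘ r ∘ k) = p v).
{ intros v. rewrite !comp_A, Hw, HpR, Hp'. reflexivity. }
assert (Hs : k ∘ w ∘ r = idm L).
{ apply epi. rewrite comp_1l.
  pose proof (Hk (exist _ _ Hwk) i0) as H. cbn in H.
  rewrite comp_1r, !comp_A in H. exact H. }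
rewrite <- (comp_1l a), <- (comp_1l b), <- Hs, <- !(comp_A (k ∘ w)).
f_equal. exact (Hr true false).
Qed.

End Limits.

(** * Abelian group objects through their hom-groups *)

Section HomGroups.
Context (E : category) (FP : fin_products E).

Section Operations.
Context (M : ab_object FP).

Definition hadd (T : E) (x y : T ~> ab_carrier M) : T ~> ab_carrier M :=
  ab_mul M ∘ pair FP x y.
Definition hzero (T : E) : T ~> ab_carrier M := ab_unit M ∘ bang FP T.
Definition hopp (T : E) (x : T ~> ab_carrier M) : T ~> ab_carrier M := ab_inv M ∘ x.
Definition hsub (T : E) (x y : T ~> ab_carrier M) : T ~> ab_carrier M :=
  hadd x (hopp y).

Lemma hadd_comp (T S : E) (x y : T ~> ab_carrier M) (u : S ~> T) :
  hadd x y ∘ u = hadd (x ∘ u) (y ∘ u).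
Proof. unfold hadd. rewrite <- comp_A, pair_comp. reflexivity. Qed.

Lemma hzero_comp (T S : E) (u : S ~> T) : hzero T ∘ u = hzero S.
Proof. unfold hzero. rewrite <- comp_A. f_equal. apply bang_eq. Qed.

Lemma hsub_comp (T S : E) (x y : T ~> ab_carrier M) (u : S ~> T) :
  hsub x y ∘ u = hsub (x ∘ u) (y ∘ u).
Proof. unfold hsub, hopp. rewrite hadd_comp, <- comp_A. reflexivity. Qed.

Lemma haddA (T : E) (x y z : T ~> ab_carrier M) :
  hadd (hadd x y) z = hadd x (hadd y z).
Proof.
pose proof (f_equal (fun h => h ∘ pair FP (pair FP x y) z) (ab_assoc M)) as H.
cbn in H. rewrite <- !comp_A, !pair_comp, <- !comp_A, !pair_comp in H.
rewrite <- !comp_A, !pr1_pair, !pr2_pair in H. exact H.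
Qed.

Lemma haddC (T : E) (x y : T ~> ab_carrier M) : hadd x y = hadd y x.
Proof.
unfold hadd at 1. rewrite <- (ab_mulC M), <- comp_A, pair_comp, pr1_pair, pr2_pair.
reflexivity.
Qed.

Lemma hadd0 (T : E) (x : T ~> ab_carrier M) : hadd x (hzero T) = x.
Proof.
pose proof (f_equal (fun h => h ∘ x) (ab_mul1 M)) as H.
cbn in H. rewrite <- comp_A, pair_comp, !comp_1l, <- comp_A in H.
rewrite (bang_eq (bang FP _ ∘ x) (bang FP T)) in H. exact H.
Qed.

Lemma hsubxx (T : E) (x : T ~> ab_carrier M) : hsub x x = hzero T.
Proof.
pose proof (f_equal (fun h => h ∘ x) (ab_mulV M)) as H.
cbn in H. rewrite <- !comp_A, pair_comp, comp_1l in H.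
rewrite (bang_eq (bang FP _ ∘ x) (bang FP T)) in H. exact H.
Qed.

Lemma hadd_cancel (T : E) (x y z : T ~> ab_carrier M) : hadd x z = hadd y z -> x = y.
Proof.
intros H. rewrite <- (hadd0 x), <- (hadd0 y), <- (hsubxx z).
unfold hsub. rewrite <- !haddA, H. reflexivity.
Qed.

Lemma hsub_add (T : E) (x y : T ~> ab_carrier M) : hadd (hsub x y) y = x.
Proof.
unfold hsub. rewrite haddA, (haddC (hopp y)). fold (hsub y y).
rewrite hsubxx. apply hadd0.
Qed.

Lemma hsub_sub0 (T : E) (x y : T ~> ab_carrier M) : hsub x (hsub (hzero T) y) = hadd x y.
Proof.
apply hadd_cancel with (hsub (hzero T) y).
rewrite hsub_add, haddA, (haddC y), hsub_add, hadd0. reflexivity.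
Qed.

Lemma hopp_sub0 (T : E) (x : T ~> ab_carrier M) : hopp x = hsub (hzero T) x.
Proof. unfold hsub. rewrite haddC, hadd0. reflexivity. Qed.

End Operations.

Arguments hzero : clear implicits.

Lemma hadd_hom (M N : ab_object FP) (f : ab_hom M N) (T : E) (x y : T ~> ab_carrier M) :
  ab_map f ∘ hadd x y = hadd (ab_map f ∘ x) (ab_map f ∘ y).
Proof.
unfold hadd. rewrite comp_A, ab_map_mul, <- comp_A, pair_comp, <- !comp_A.
rewrite pr1_pair, pr2_pair. reflexivity.
Qed.

Lemma hzero_hom (M N : ab_object FP) (f : ab_hom M N) (T : E) :
  ab_map f ∘ hzero M T = hzero N T.
Proof.
apply hadd_cancel with (ab_map f ∘ hzero M T).
rewrite <- hadd_hom, hadd0, haddC, hadd0. reflexivity.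
Qed.

Lemma hsub_hom (M N : ab_object FP) (f : ab_hom M N) (T : E) (x y : T ~> ab_carrier M) :
  ab_map f ∘ hsub x y = hsub (ab_map f ∘ x) (ab_map f ∘ y).
Proof.
apply hadd_cancel with (ab_map f ∘ y).
rewrite <- hadd_hom, !hsub_add. reflexivity.
Qed.

Definition additive (M N : ab_object FP) (f : ab_carrier M ~> ab_carrier N) : Prop :=
  forall (T : E) (x y : T ~> ab_carrier M), f ∘ hadd x y = hadd (f ∘ x) (f ∘ y).

(** Additivity at the two projections from the product is the defining equation of
    a homomorphism. *)
Lemma additive_hom (M N : ab_object FP) (f : ab_carrier M ~> ab_carrier N) :
  additive (M := M) (N := N) f -> exists g : ab_hom M N, ab_map g = f.
Proof.
intros H. unshelve eexists (@AbHom E FP M N f _); [|reflexivity].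
rewrite <- (comp_1r (ab_mul M)).
replace (idm (prd FP (ab_carrier M) (ab_carrier M)))
  with (pair FP (pr1 FP (ab_carrier M) (ab_carrier M)) (pr2 FP (ab_carrier M) (ab_carrier M))).
- apply H.
- apply pair_eq; rewrite comp_1r; [apply pr1_pair | apply pr2_pair].
Qed.

(** ** Abelian group objects inside a family of others *)

(** Let [p] embed [L] jointly into abelian group objects. If the maps to [L] are
    closed under zero and differences, then they form groups, naturally in the
    source, and [L] is an abelian group object by the Yoneda lemma. This covers
    subobjects (a single [p]) as well as limits. *)
Section AbSub.
Context (V : Type) (M : V -> ab_object FP) (L : E) (p : forall v, L ~> ab_carrier (M v)).
Context (Hmono : jointly_monic p).
Context (Hzero : forall T : E, exists z : T ~> L, forall v, p v ∘ z = hzero (M v) T).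
Context (Hsub : forall (T : E) (x y : T ~> L), exists z : T ~> L,
  forall v, p v ∘ z = hsub (p v ∘ x) (p v ∘ y)).

Lemma ab_sub_add (T : E) (x y : T ~> L) :
  exists z : T ~> L, forall v, p v ∘ z = hadd (p v ∘ x) (p v ∘ y).
Proof.
destruct (Hzero T) as [o Ho], (Hsub o y) as [y' Hy'], (Hsub x y') as [z Hz].
exists z. intros v. rewrite Hz, Hy', Ho. apply hsub_sub0.
Qed.

Lemma ab_sub_opp (T : E) (x : T ~> L) :
  exists z : T ~> L, forall v, p v ∘ z = hopp (p v ∘ x).
Proof.
destruct (Hzero T) as [o Ho], (Hsub o x) as [z Hz].
exists z. intros v. rewrite Hz, Ho. symmetry. apply hopp_sub0.
Qed.

Definition ab_sub_mul : prd FP L L ~> L :=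
  proj1_sig (constructive_indefinite_description _ (ab_sub_add (pr1 FP L L) (pr2 FP L L))).
Definition ab_sub_unit : term FP ~> L :=
  proj1_sig (constructive_indefinite_description _ (Hzero (term FP))).
Definition ab_sub_inv : L ~> L :=
  proj1_sig (constructive_indefinite_description _ (ab_sub_opp (idm L))).

Lemma ab_sub_mulE (v : V) (T : E) (x y : T ~> L) :
  p v ∘ (ab_sub_mul ∘ pair FP x y) = hadd (p v ∘ x) (p v ∘ y).
Proof.
rewrite comp_A. unfold ab_sub_mul.
rewrite (proj2_sig (constructive_indefinite_description _
  (ab_sub_add (pr1 FP L L) (pr2 FP L L))) v).
rewrite hadd_comp, <- !comp_A, pr1_pair, pr2_pair. reflexivity.
Qed.

Lemma ab_sub_unitE (v : V) (T : E) (u : T ~> term FP) :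
  p v ∘ (ab_sub_unit ∘ u) = hzero (M v) T.
Proof.
rewrite comp_A. unfold ab_sub_unit.
rewrite (proj2_sig (constructive_indefinite_description _ (Hzero (term FP))) v). apply hzero_comp.
Qed.

Lemma ab_sub_invE (v : V) : p v ∘ ab_sub_inv = hopp (p v).
Proof.
unfold ab_sub_inv.
rewrite (proj2_sig (constructive_indefinite_description _ (ab_sub_opp (idm L))) v).
rewrite comp_1r. reflexivity.
Qed.

Definition ab_sub : ab_object FP.
Proof.
refine (@AbObject E FP L ab_sub_mul ab_sub_unit ab_sub_inv _ _ _ _).
- intros AA x y z. apply Hmono. intros v. rewrite !ab_sub_mulE. apply haddA.
- apply Hmono. intros v. rewrite ab_sub_mulE, ab_sub_unitE, comp_1r. apply hadd0.
- apply Hmono. intros v. rewrite ab_sub_mulE, ab_sub_unitE, comp_1r, ab_sub_invE.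
  apply hsubxx.
- apply Hmono. intros v. rewrite ab_sub_mulE, haddC, <- ab_sub_mulE.
  rewrite comp_A. rewrite <- (comp_1r (p v ∘ ab_sub_mul)) at 2. f_equal.
  apply pair_eq; rewrite comp_1r; [apply pr1_pair | apply pr2_pair].
Defined.

Lemma ab_sub_hom_exists (v : V) : exists g : ab_hom ab_sub (M v), ab_map g = p v.
Proof. apply additive_hom. intros T x y. apply ab_sub_mulE. Qed.

Definition ab_sub_hom (v : V) : ab_hom ab_sub (M v) :=
  proj1_sig (constructive_indefinite_description _ (ab_sub_hom_exists v)).

Lemma ab_sub_homE (v : V) : ab_map (ab_sub_hom v) = p v.
Proof. apply (proj2_sig (constructive_indefinite_description _ (ab_sub_hom_exists v))). Qed.

End AbSub.

End HomGroups.

Arguments hzero [E FP] M T.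
Arguments additive [E FP M N] f.

(** * Skolem hulls *)

Inductive expr (S L K : Small) : Small :=
| leaf (s : S)
| node (l : L) (args : K -> expr S L K).

(** Downward Löwenheim-Skolem: the values of expressions are closed under the rules
    [R], where each node picks a solution of its rule if there is one. What
    matters is that one type of expressions serves all [Z] and [R]. *)
Lemma skolem_hull (S L K : Small) (k0 : K) (Z : Type) (s : S -> Z)
  (R : L -> (K -> Z) -> Z -> Prop) :
  exists ev : expr S L K -> Z, (forall x, exists t, ev t = s x) /\
    forall (l : L) (t : K -> expr S L K),
      (exists z, R l (fun k => ev (t k)) z) ->
      exists t', R l (fun k => ev (t k)) (ev t').
Proof.
destruct (dependent_choice (A := L * (K -> Z)) (B := fun _ => Z)
  (R := fun lz z' => (exists z, R (fst lz) (snd lz) z) -> R (fst lz) (snd lz) z'))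
  as [op Hop].
{ intros [l z]. cbn. destruct (classic (exists z', R l z z')) as [[z' Hz']|N].
  - exists z'. auto.
  - exists (z k0). intros H. destruct (N H). }
exists (fix ev t := match t with
  | leaf _ _ x => s x
  | node l t => op (l, fun k => ev (t k))
  end).
split.
- intros x. exists (leaf L K x). reflexivity.
- intros l t H. exists (node l t). exact (Hop (l, _) H).
Qed.

(** * Small subobjects of abelian group objects *)

(** As the objects are indexed by a fixed [T] and the maps are those between
    generators, there is only a small set of such diagrams, in contrast to all
    diagrams on small categories. *)
Record subdiagram (E : category) (I : Small) (G : I -> E) (T : Small) : Small :=
SubDiagram {
  sd_index : T -> I;
  sd_arrow : forall t t' : T, (G (sd_index t) ~> G (sd_index t')) -> Prop;
  sd_arrow_id : forall t, sd_arrow (idm (G (sd_index t)));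
  sd_arrow_comp : forall t t' t'' (k : G (sd_index t') ~> G (sd_index t''))
    (h : G (sd_index t) ~> G (sd_index t')),
    sd_arrow k -> sd_arrow h -> sd_arrow (k ∘ h)
}.

Section SubDiagram.
Context (E : category) (I : Small) (G : I -> E) (T : Small) (D : subdiagram G T).

Definition sd_hom (t t' : T) : Small :=
  {h : G (sd_index D t) ~> G (sd_index D t') | sd_arrow h}.

Lemma sd_hom_eq (t t' : T) (h k : sd_hom t t') : proj1_sig h = proj1_sig k -> h = k.
Proof.
destruct h as [h Hh], k as [k Hk]. cbn. intros ->. f_equal. apply proof_irrelevance.
Qed.

Definition sd_category : small_category.
Proof.
unshelve refine (@SmallCategory T (@CategoryOn T sd_hom
  (fun t => exist _ _ (sd_arrow_id D t))
  (fun t t' t'' k h => exist _ _ (sd_arrow_comp (proj2_sig k) (proj2_sig h))) _ _ _)).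
- intros x y h. apply sd_hom_eq, comp_1l.
- intros x y h. apply sd_hom_eq, comp_1r.
- intros x y z w h k l. apply sd_hom_eq, comp_A.
Defined.

Definition sd_functor : functor sd_category E :=
  @Functor sd_category E (fun t : T => G (sd_index D t))
    (fun x y (h : sd_hom x y) => proj1_sig h)
    (fun x => eq_refl) (fun x y z k h => eq_refl).

End SubDiagram.

Section Hull.
Context (K : Small) (HK : regular_cardinal K).
Context (E : category) (I : Small) (G : I -> E) (HG : generated K G).
Context (FP : fin_products E).

(** The closure properties of the set of maps to [M]: bounds of [K] maps, maps
    which coequalize [K] given maps, and differences of two restrictions. The last
    two concern a single map, the argument at a fixed element of [K]. *)
Inductive hull_rule : Small :=
| rule_bound
| rule_coequalize (i k : I) (p : K -> (G i ~> G k))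
| rule_sub (i k : I) (h h' : G i ~> G k).

(** The starting points are the restrictions of [A ~> M] to the generators, and a
    zero map from each generator. *)
Definition hull_expr (A : E) : Small := expr ({i : I & G i ~> A} + I)%type hull_rule K.

Section Subobject.
Context (M : ab_object FP) (T : Small) (ev : T -> {i : I & G i ~> ab_carrier M}).

Let idx (t : T) : I := projT1 (ev t).
Let elt (t : T) : G (idx t) ~> ab_carrier M := projT2 (ev t).

Context (Hbound : forall (A : Small) (x : A -> T), card_lt A K ->
  exists t, forall a, exists u : G (idx (x a)) ~> G (idx t), elt t ∘ u = elt (x a)).
Context (Hcoeq : forall (A : Small) (t : T) (i : I) (p : A -> (G i ~> G (idx t))),
  card_lt A K -> (forall a b, elt t ∘ p a = elt t ∘ p b) ->
  exists (t' : T) (w : G (idx t) ~> G (idx t')),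
    elt t' ∘ w = elt t /\ forall a b, w ∘ p a = w ∘ p b).
Context (Hsub : forall (t : T) (i : I) (h h' : G i ~> G (idx t)),
  exists (t' : T) (g : G i ~> G (idx t')), elt t' ∘ g = hsub (elt t ∘ h) (elt t ∘ h')).
Context (Hzero : forall i : I, exists (t : T) (g : G i ~> G (idx t)),
  elt t ∘ g = hzero M (G i)).

Definition hull_diagram : subdiagram G T.
Proof.
refine (@SubDiagram E I G T idx (fun t t' h => elt t' ∘ h = elt t) _ _).
- intros t. apply comp_1r.
- intros t t' t'' k h Hk Hh. rewrite comp_A, Hk. exact Hh.
Defined.

Lemma hull_filtered : filtered K (sd_category hull_diagram).
Proof.
apply filtered_of_bounds; [exact HK| |].
- intros A x HA. destruct (Hbound x HA) as [t Ht].
  exists t. destruct (dependent_choice Ht) as [u Hu].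
  constructor. intros a. exact (exist _ (u a) (Hu a)).
- intros A x y p HA.
  destruct (@Hcoeq A y (idx x) (fun a => proj1_sig (p a)) HA) as (t' & w & Hw & Hp).
  + intros a b. exact (eq_trans (proj2_sig (p a)) (eq_sym (proj2_sig (p b)))).
  + exists t', (exist _ w Hw). intros a b. apply sd_hom_eq. exact (Hp a b).
Qed.

Context (c : cocone (sd_functor hull_diagram)) (Hc : is_colimit c).

Lemma hull_map_exists : exists m : apex c ~> ab_carrier M, forall t : T, m ∘ leg c t = elt t.
Proof.
unshelve epose (d := @Cocone _ E (sd_functor hull_diagram) (ab_carrier M) elt _).
{ intros t t' h. exact (proj2_sig h). }
destruct (Hc d) as [m [Hm _]]. exists m. exact Hm.
Qed.

Context (m : apex c ~> ab_carrier M) (Hm : forall t : T, m ∘ leg c t = elt t).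

Lemma hull_factor (i : I) (g : G i ~> apex c) :
  exists (t : T) (h : G i ~> G (idx t)), leg c t ∘ h = g.
Proof.
destruct (proj1 (proj1 HG i _ _ c hull_filtered Hc) g) as (t & h & e).
exists t, h. exact e.
Qed.

Lemma hull_factor2 (i : I) (g g' : G i ~> apex c) :
  exists (t : T) (h h' : G i ~> G (idx t)), leg c t ∘ h = g /\ leg c t ∘ h' = g'.
Proof.
destruct (hull_factor g) as (t & h & <-), (hull_factor g') as (t' & h' & <-).
destruct (bounds2 (t : sd_category hull_diagram) t' HK
  (filtered_bounds hull_filtered)) as [s [[u u']]].
exists s, (proj1_sig u ∘ h), (proj1_sig u' ∘ h').
rewrite !comp_A. split; f_equal; [exact (leg_nat c u) | exact (leg_nat c u')].
Qed.

(** By filteredness, two maps from a generator to the colimit are given at one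
    stage. If they agree in [M], then a map in the diagram makes them equal. *)
Lemma hull_monic (S : E) (x y : S ~> apex c) : m ∘ x = m ∘ y -> x = y.
Proof.
intros e. apply (generated_eq HG). intros i g.
destruct (hull_factor2 (x ∘ g) (y ∘ g)) as (t & h & h' & Hx & Hy).
destruct (@Hcoeq bool t i (fun b : bool => if b then h else h') (card_lt_bool HK))
  as (t' & w & Hw & Hp).
{ assert (elt t ∘ h = elt t ∘ h').
  { rewrite <- Hm, <- !comp_A, Hx, Hy, !comp_A, e. reflexivity. }
  intros [] []; congruence. }
rewrite <- Hx, <- Hy.
assert (El : leg c t' ∘ w = leg c t) by exact (leg_nat c (exist _ w Hw)).
rewrite <- El, <- !comp_A. f_equal. exact (Hp true false).
Qed.

(** As the subobject is monic, a map into [M] lands in it as soon as its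
    restrictions to the generators do. *)
Lemma hull_lift (S : E) (x : S ~> ab_carrier M) :
  (forall i (g : G i ~> S), exists (t : T) (h : G i ~> G (idx t)), elt t ∘ h = x ∘ g) ->
  exists y : S ~> apex c, m ∘ y = x.
Proof.
intros H.
assert (H' : forall s : {i : I & G i ~> S}, exists y : G (projT1 s) ~> apex c,
  m ∘ y = x ∘ projT2 s).
{ intros [i g]. destruct (H i g) as (t & h & e).
  exists (leg c t ∘ h). rewrite comp_A, Hm. exact e. }
destruct (dependent_choice H') as [f Hf].
pose (phi := fun i (g : G i ~> S) => f (existT _ i g) : G i ~> apex c).
assert (Hphi : forall i (g : G i ~> S), m ∘ phi i g = x ∘ g).
{ intros i g. exact (Hf (existT _ i g)). }
destruct (generated_dense HG (T := S) (W := apex c) (phi := phi))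
  as [y Hy].
{ intros i j h g. apply hull_monic.
  rewrite comp_A, !Hphi. apply comp_A. }
exists y. apply (generated_eq HG). intros i g.
rewrite <- comp_A, Hy. apply Hphi.
Qed.

Lemma hull_zero (S : E) : exists z : S ~> apex c, m ∘ z = hzero M S.
Proof. apply hull_lift. intros i g. rewrite hzero_comp. apply Hzero. Qed.

Lemma hull_sub (S : E) (x y : S ~> apex c) :
  exists z : S ~> apex c, m ∘ z = hsub (m ∘ x) (m ∘ y).
Proof.
apply hull_lift. intros i g.
destruct (hull_factor2 (x ∘ g) (y ∘ g)) as (t & h & h' & Hx & Hy).
destruct (Hsub h h') as (t' & g' & e). exists t', g'.
rewrite e, hsub_comp, <- !comp_A, <- Hx, <- Hy, !comp_A, Hm. reflexivity.
Qed.

End Subobject.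

Lemma hull_exists (A : E) (M : ab_object FP) (a : A ~> ab_carrier M) :
  exists ev : hull_expr A -> {i : I & G i ~> ab_carrier M},
    (forall (A' : Small) (x : A' -> hull_expr A), card_lt A' K ->
      exists t, forall b, exists u : G (projT1 (ev (x b))) ~> G (projT1 (ev t)),
        projT2 (ev t) ∘ u = projT2 (ev (x b))) /\
    (forall (A' : Small) (t : hull_expr A) (i : I) (p : A' -> (G i ~> G (projT1 (ev t)))),
      card_lt A' K -> (forall b b', projT2 (ev t) ∘ p b = projT2 (ev t) ∘ p b') ->
      exists (t' : hull_expr A) (w : G (projT1 (ev t)) ~> G (projT1 (ev t'))),
        projT2 (ev t') ∘ w = projT2 (ev t) /\ forall b b', w ∘ p b = w ∘ p b') /\
    (forall (t : hull_expr A) (i : I) (h h' : G i ~> G (projT1 (ev t))),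
      exists (t' : hull_expr A) (g : G i ~> G (projT1 (ev t'))),
        projT2 (ev t') ∘ g = hsub (projT2 (ev t) ∘ h) (projT2 (ev t) ∘ h')) /\
    (forall i (g : G i ~> A), exists t, ev t = existT _ i (a ∘ g)) /\
    (forall i, exists t, ev t = existT _ i (hzero M (G i))).
Proof.
destruct (proj1 HK) as [nu _]. pose (k0 := nu 0).
pose (Z := {i : I & G i ~> ab_carrier M}).
pose (R := fun (l : hull_rule) (z : K -> Z) (z' : Z) =>
  match l with
  | rule_bound => forall x, exists u : G (projT1 (z x)) ~> G (projT1 z'),
      projT2 z' ∘ u = projT2 (z x)
  | @rule_coequalize i k p => exists m : G k ~> ab_carrier M, z k0 = existT _ k m /\
      exists w : G k ~> G (projT1 z'), projT2 z' ∘ w = m /\ forall x y, w ∘ p x = w ∘ p y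
  | @rule_sub i k h h' => exists m : G k ~> ab_carrier M, z k0 = existT _ k m /\
      exists g : G i ~> G (projT1 z'), projT2 z' ∘ g = hsub (m ∘ h) (m ∘ h')
  end).
pose (s := fun x : {i : I & G i ~> A} + I => match x with
  | inl (existT _ i g) => existT _ i (a ∘ g) | inr i => existT _ i (hzero M (G i)) end : Z).
destruct (skolem_hull k0 s R) as (ev & Hs & HR).
exists ev. split; [|split; [|split; [|split]]].
- intros A' x HA.
  destruct (classic (inhabited A')) as [[b0]|HA0]; cycle 1.
  { destruct (generated_bounds HG (M := ab_carrier M) (A := Empty_set)
      (i := fun e => match e with end) (fun e => match e with end) (card_lt_empty HK))
      as (i & _).
    destruct (Hs (inr i)) as [t _].
    exists t. intros b. destruct HA0. constructor. exact b. }
  destruct (card_le_surjection b0 (proj1 HA)) as [r Hr].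
  destruct (HR rule_bound (fun y => x (r y))) as [t Ht].
  { destruct (generated_bounds HG (fun b => projT2 (ev (x b))) HA) as (i & m & Hm).
    exists (existT _ i m). intros y. exact (Hm (r y)). }
  exists t. intros b. destruct (Hr b) as [y <-]. exact (Ht y).
- intros A' t i p HA Hp.
  destruct (classic (inhabited A')) as [[b0]|HA0]; cycle 1.
  { exists t, (idm _). split; [apply comp_1r|].
    intros b. destruct HA0. constructor. exact b. }
  destruct (card_le_surjection b0 (proj1 HA)) as [r Hr].
  destruct (HR (rule_coequalize (fun y => p (r y))) (fun _ => t)) as (t' & m & em & w & Hw & Hpw).
  { destruct (generated_coequalizing HK HG HA Hp) as (l & m' & w & Hw & Hpw).
    exists (existT _ l m'), (projT2 (ev t)). split; [apply sigT_eta|].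
    exists w. split; [exact Hw|]. intros y y'. apply Hpw. }
  apply (eq_trans (eq_sym (sigT_eta (ev t)))), EqdepTheory.inj_pair2 in em. subst m.
  exists t', w. split; [exact Hw|].
  intros b b'. destruct (Hr b) as [y <-], (Hr b') as [y' <-]. apply Hpw.
- intros t i h h'.
  destruct (HR (rule_sub h h') (fun _ => t)) as (t' & m & em & g & Hg).
  { exists (existT _ i (hsub (projT2 (ev t) ∘ h) (projT2 (ev t) ∘ h'))), (projT2 (ev t)).
    split; [apply sigT_eta|]. exists (idm _). apply comp_1r. }
  apply (eq_trans (eq_sym (sigT_eta (ev t)))), EqdepTheory.inj_pair2 in em. subst m.
  exists t', g. exact Hg.
- intros i g. apply (Hs (inl (existT _ i g))).
- intros i. apply (Hs (inr i)).
Qed.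

(** The diagram depends on [M] and [a], but its type of objects only on [A]. *)
Lemma small_subobject (A : E) (M : ab_object FP) (a : A ~> ab_carrier M) :
  exists D : subdiagram G (hull_expr A),
    forall c : cocone (sd_functor D), is_colimit c ->
    exists m : apex c ~> ab_carrier M,
      (forall (S : E) (x y : S ~> apex c), m ∘ x = m ∘ y -> x = y) /\
      (exists a' : A ~> apex c, m ∘ a' = a) /\
      (forall S : E, exists z : S ~> apex c, m ∘ z = hzero M S) /\
      (forall (S : E) (x y : S ~> apex c), exists z : S ~> apex c,
        m ∘ z = hsub (m ∘ x) (m ∘ y)).
Proof.
destruct (hull_exists a) as (ev & Hb & Hc & Hs & Ha & Hz).
exists (hull_diagram ev). intros c Hcol.
destruct (hull_map_exists Hcol) as [m Hm].
exists m. split; [|split; [|split]].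
- intros S x y. apply (hull_monic Hb Hc Hcol Hm).
- apply (hull_lift Hb Hc Hcol Hm). intros i g.
  destruct (Ha i g) as [t Ht]. exists t. rewrite Ht. exists (idm _). apply comp_1r.
- apply (hull_zero Hb Hc). 2: exact Hcol. 2: exact Hm.
  intros i. destruct (Hz i) as [t Ht]. exists t. rewrite Ht. exists (idm _). apply comp_1r.
- intros S. apply (hull_sub Hb Hc Hs Hcol Hm).
Qed.

(** The structure maps over the carrier. Over a fixed carrier they form a small
    type, in contrast to [ab_object]. *)
Definition ab_pack (N : ab_object FP) :
  {c : E & ((prd FP c c ~> c) * (term FP ~> c) * (c ~> c))%type} :=
  existT _ (ab_carrier N) (ab_mul N, ab_unit N, ab_inv N).

Lemma ab_pack_inj (N N' : ab_object FP) : ab_pack N = ab_pack N' -> N = N'.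
Proof.
destruct N as [c m u i A1 A2 A3 A4], N' as [c' m' u' i' A1' A2' A3' A4'].
unfold ab_pack. cbn. intros e.
pose proof (f_equal (@projT1 _ _) e) as ec. cbn in ec. subst c'.
apply EqdepTheory.inj_pair2 in e. injection e as -> -> ->.
f_equal; apply proof_irrelevance.
Qed.

Context (hE : cocomplete E).

(** An index consists of a diagram, for the carrier, and of structure maps which
    make its colimit an abelian group object. *)
Lemma solution_set (A : E) :
  exists (O : Small) (N : O -> ab_object FP),
    forall (M : ab_object FP) (a : A ~> ab_carrier M),
      exists (o : O) (m : ab_hom (N o) M) (a' : A ~> ab_carrier (N o)),
        (forall (S : E) (x y : S ~> ab_carrier (N o)),
          ab_map m ∘ x = ab_map m ∘ y -> x = y) /\
        ab_map m ∘ a' = a.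
Proof.
destruct (dependent_choice (fun D : subdiagram G (hull_expr A) => hE (sd_functor D)))
  as [c Hc].
pose (O := {D : subdiagram G (hull_expr A) &
  {s : (prd FP (apex (c D)) (apex (c D)) ~> apex (c D)) *
       (term FP ~> apex (c D)) * (apex (c D) ~> apex (c D)) |
   exists N, ab_pack N = existT _ (apex (c D)) s}} : Small).
destruct (dependent_choice (fun o : O => proj2_sig (projT2 o))) as [N HN].
exists O, N. intros M a.
destruct (small_subobject a) as [D HD].
destruct (HD (c D) (Hc D)) as (m & Hmono & [a' Ha'] & Hz & Hs).
pose (Hmono1 := (fun S x y e => Hmono S x y (e tt)) : jointly_monic (fun _ : unit => m)).
assert (Hz1 : forall S, exists z, forall _ : unit, m ∘ z = hzero M S).
{ intros S. destruct (Hz S) as [z Ez]. exists z. intros _. exact Ez. }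
assert (Hs1 : forall S (x y : S ~> apex (c D)), exists z, forall _ : unit,
  m ∘ z = hsub (m ∘ x) (m ∘ y)).
{ intros S x y. destruct (Hs S x y) as [z Ez]. exists z. intros _. exact Ez. }
pose (B := ab_sub (M := fun _ : unit => M) Hmono1 Hz1 Hs1).
pose (o := existT _ D (exist _ (projT2 (ab_pack B)) (ex_intro _ B eq_refl)) : O).
assert (e : N o = B) by (apply ab_pack_inj; apply (HN o)).
destruct (ab_sub_hom_exists (M := fun _ : unit => M) Hmono1 Hz1 Hs1 tt) as [g Hg].
exists o. rewrite e. exists g, a'.
pose (Q := fun f : apex (c D) ~> ab_carrier M =>
  (forall (S : E) (x y : S ~> apex (c D)), f ∘ x = f ∘ y -> x = y) /\ f ∘ a' = a).
exact (eq_ind_r Q (conj Hmono Ha') Hg).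
Qed.

(** * Universal maps to abelian group objects *)

Lemma ab_graph_limit (V : Small) (M : V -> ab_object FP) (Q : V -> V -> Small)
  (f : forall v v', Q v v' -> ab_hom (M v) (M v')) :
  exists (L : ab_object FP) (p : forall v, ab_hom L (M v)),
    graph_cone (fun v v' q => ab_map (f v v' q)) (fun v => ab_map (p v)) /\
    forall (T : E) (s : forall v, T ~> ab_carrier (M v)),
      graph_cone (fun v v' q => ab_map (f v v' q)) s ->
      exists! t : T ~> ab_carrier L, forall v, ab_map (p v) ∘ t = s v.
Proof.
destruct (graph_limit (fun v v' q => ab_map (f v v' q)) HG hE) as (L & p & Hp & HL).
pose proof (graph_limit_jointly_monic Hp HL) as Hmono.
assert (Hzero : forall T, exists z : T ~> L, forall v, p v ∘ z = hzero (M v) T).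
{ intros T. destruct (HL T (fun v => hzero (M v) T)) as [z [Hz _]].
  - intros v v' q. apply hzero_hom.
  - exists z. exact Hz. }
assert (Hsub : forall T (x y : T ~> L), exists z : T ~> L,
  forall v, p v ∘ z = hsub (p v ∘ x) (p v ∘ y)).
{ intros T x y. destruct (HL T (fun v => hsub (p v ∘ x) (p v ∘ y))) as [z [Hz _]].
  - intros v v' q. rewrite hsub_hom, !comp_A, Hp. reflexivity.
  - exists z. exact Hz. }
exists (ab_sub Hmono Hzero Hsub), (ab_sub_hom Hmono Hzero Hsub).
pose (P := fun p : forall v, L ~> ab_carrier (M v) =>
  graph_cone (fun v v' q => ab_map (f v v' q)) p /\
  forall (T : E) (s : forall v, T ~> ab_carrier (M v)),
    graph_cone (fun v v' q => ab_map (f v v' q)) s ->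
    exists! t : T ~> L, forall v, p v ∘ t = s v).
refine (eq_ind_r P (conj Hp HL) (_ : (fun v => ab_map (ab_sub_hom Hmono Hzero Hsub v)) = p)).
apply functional_extensionality_dep. intros v. apply ab_sub_homE.
Qed.

(** The initial object of the category of selected maps, as the limit [L] over the
    full subcategory on the solution set. For uniqueness, the equalizer [k] of two
    maps from [L] receives a map [m] from a member [v] of the solution set, and
    [k ∘ m ∘ p v] is an endomorphism of the limit cone, hence the identity, so that
    the equalizer is everything. *)
Theorem universal_ab_object (A : E) (Phi : forall M : ab_object FP, (A ~> ab_carrier M) -> Prop) :
  (forall (V : Small) (M : V -> ab_object FP) (L : ab_object FP)
    (p : forall v, ab_hom L (M v)), jointly_monic (fun v => ab_map (p v)) ->
    forall a, (forall v, Phi (M v) (ab_map (p v) ∘ a)) -> Phi L a) ->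
  exists (L : ab_object FP) (a0 : A ~> ab_carrier L), Phi L a0 /\
    forall (M : ab_object FP) (b : A ~> ab_carrier M), Phi M b ->
      exists! h : ab_hom L M, ab_map h ∘ a0 = b.
Proof.
intros HPhi.
destruct (solution_set A) as (O & N & HN).
pose (V := {o : O & {a : A ~> ab_carrier (N o) | Phi (N o) a}} : Small).
pose (el := fun v : V => proj1_sig (projT2 v) : A ~> ab_carrier (N (projT1 v))).
assert (weakly_initial : forall (M : ab_object FP) (b : A ~> ab_carrier M), Phi M b ->
  exists (v : V) (m : ab_hom (N (projT1 v)) M), ab_map m ∘ el v = b).
{ intros M b Hb. destruct (HN M b) as (o & m & a & Hm & Ha).
  assert (Pa : Phi (N o) a).
  { apply (HPhi unit (fun _ => M) (N o) (fun _ => m)).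
    - intros S x y e. exact (Hm S x y (e tt)).
    - intros _. rewrite Ha. exact Hb. }
  exists (existT _ o (exist _ a Pa)), m. exact Ha. }
pose (Q := fun v v' : V => {h : ab_hom (N (projT1 v)) (N (projT1 v')) |
  ab_map h ∘ el v = el v'} : Small).
destruct (ab_graph_limit (M := fun v : V => N (projT1 v)) (Q := Q)
  (fun v v' q => proj1_sig q)) as (L & p & Hp & HL).
destruct (HL A el) as [a0 [Ha0 _]].
{ intros v v' q. exact (proj2_sig q). }
pose proof (graph_limit_jointly_monic Hp HL) as Hmono.
assert (PL : Phi L a0).
{ apply (HPhi V _ L p Hmono). intros v. rewrite Ha0. exact (proj2_sig (projT2 v)). }
exists L, a0. split; [exact PL|].
intros M b Hb. destruct (weakly_initial M b Hb) as (v & m & Hm).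
exists (ab_hom_comp m (p v)). split.
{ cbn. rewrite <- comp_A, Ha0. exact Hm. }
intros g Hg. set (f := ab_hom_comp m (p v)).
assert (Hf : ab_map f ∘ a0 = b).
{ cbn. rewrite <- comp_A, Ha0. exact Hm. }
clearbody f. clear v m Hm.
destruct (ab_graph_limit (M := fun b : bool => if b then M else L) (Q := parallel_hom bool)
  (fun b b' => match b, b' return parallel_hom bool b b' ->
      ab_hom (if b then M else L) (if b' then M else L) with
    | false, true => fun i : bool => if i then f else g
    | true, false => fun e : Empty_set => match e with end
    | true, true => fun _ => ab_hom_id M
    | false, false => fun _ => ab_hom_id L
    end)) as (Eq & k & Hk & HEq).
pose proof (Hk false true true) as Hkf. pose proof (Hk false true false) as Hkg.
cbn in Hkf, Hkg.
assert (lift : forall (T : E) (x : T ~> ab_carrier L), ab_map f ∘ x = ab_map g ∘ x ->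
  exists! t : T ~> ab_carrier Eq, ab_map (k false) ∘ t = x).
{ intros T x e.
  destruct (HEq T (fun b : bool => match b with true => ab_map f ∘ x | false => x end))
    as [t [Ht Ut]].
  - intros [] [] q; cbn; [apply comp_1l | destruct q | | apply comp_1l].
    destruct q; [reflexivity | symmetry; exact e].
  - exists t. split; [exact (Ht false)|]. intros t' Ht'. apply Ut.
    intros []; [|exact Ht']. rewrite <- Hkf, <- comp_A, Ht'. reflexivity. }
destruct (lift A a0) as [a1 [Ha1 _]].
{ rewrite Hf. symmetry. exact Hg. }
assert (PEq : Phi Eq a1).
{ apply (HPhi unit (fun _ => L) Eq (fun _ => k false)).
  - intros T x y e. destruct (lift T (ab_map (k false) ∘ y)) as [t [_ Ht]].
    + rewrite !comp_A. f_equal. rewrite Hkf, Hkg. reflexivity.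
    + transitivity t; [symmetry|]; apply Ht; [exact (e tt) | reflexivity].
  - intros _. rewrite Ha1. exact PL. }
destruct (weakly_initial Eq a1 PEq) as (v & m & Hm).
assert (Hid : ab_map (k false) ∘ (ab_map m ∘ ab_map (p v)) = idm _).
{ apply Hmono. intros v'. rewrite comp_1r, !comp_A.
  pose (h := ab_hom_comp (p v') (ab_hom_comp (k false) m)).
  assert (Hh : ab_map h ∘ el v = el v').
  { unfold h. cbn. rewrite <- !comp_A, Hm, Ha1. apply Ha0. }
  pose proof (Hp v v' (exist _ h Hh)) as e. cbn in e. rewrite !comp_A in e. exact e. }
apply ab_hom_eq. rewrite <- (comp_1r (ab_map f)), <- (comp_1r (ab_map g)), <- Hid.
rewrite !(comp_A _ (ab_map (k false))). f_equal. rewrite Hkf, Hkg. reflexivity.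
Qed.

End Hull.

(** * Adjoints from universal arrows *)

Definition universal_arrow (C D : category) (R : functor D C) (A : C) (d : D)
  (eta : A ~> R d) : Prop :=
  forall (d' : D) (g : A ~> R d'), exists! h : d ~> d', fmap R h ∘ eta = g.

Lemma left_adjoint_of_universal_arrows (C D : category) (R : functor D C) :
  (forall A : C, exists (d : D) (eta : A ~> R d), universal_arrow eta) ->
  has_left_adjoint R.
Proof.
intros H.
destruct (dependent_choice (B := fun A => {d : D & A ~> R d})
  (R := fun A s => universal_arrow (projT2 s))) as [s Hs].
{ intros A. destruct (H A) as (d & eta & Hd). exists (existT _ d eta). exact Hd. }
pose (L := fun A => projT1 (s A)).
pose (eta := fun A => projT2 (s A) : A ~> R (L A)).
assert (ex : forall A d (g : A ~> R d), exists h : L A ~> d, fmap R h ∘ eta A = g).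
{ intros A d g. destruct (Hs A d g) as [h [Hh _]]. exists h. exact Hh. }
assert (uq : forall A d (h h' : L A ~> d),
  fmap R h ∘ eta A = fmap R h' ∘ eta A -> h = h').
{ intros A d h h' e. destruct (Hs A d (fmap R h' ∘ eta A)) as [t [_ Ht]].
  transitivity t; [symmetry|]; apply Ht; [exact e | reflexivity]. }
pose (tr := fun A d (g : A ~> R d) =>
  proj1_sig (constructive_indefinite_description _ (ex A d g))).
assert (Htr : forall A d (g : A ~> R d), fmap R (tr A d g) ∘ eta A = g).
{ intros A d g. exact (proj2_sig (constructive_indefinite_description _ (ex A d g))). }
clearbody tr.
unshelve epose (LF := @Functor C D L (fun A B f => tr A (L B) (eta B ∘ f)) _ _).
{ intros A. apply uq. rewrite Htr, fmap_id, comp_1l, comp_1r. reflexivity. }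
{ intros A B B' g f. apply uq.
  rewrite Htr, fmap_comp, <- (comp_A (fmap R _)), Htr, !comp_A, Htr. reflexivity. }
unshelve epose (u := @NatTrans C C (functor_id C) (functor_comp R LF) eta _).
{ intros A B f. symmetry. exact (Htr A (L B) (eta B ∘ f)). }
unshelve epose (e := @NatTrans D D (functor_comp LF R) (functor_id D)
  (fun d => tr (R d) d (idm (R d))) _).
{ intros d d' f. apply uq. cbn.
  rewrite !fmap_comp, <- !comp_A, !Htr, comp_A, Htr, comp_1l, comp_1r. reflexivity. }
exists LF. constructor. apply (@Adjunction C D LF R u e).
- intros A. apply uq. cbn.
  rewrite fmap_comp, <- comp_A, Htr, comp_A, Htr, fmap_id. reflexivity.
- intros d. apply Htr.
Qed.

(** * Left adjoints on abelian group objects *)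

Section AbAdjoints.
Context (K : Small) (HK : regular_cardinal K).
Context (E : category) (hE : cocomplete E) (I : Small) (G : I -> E) (HG : generated K G).
Context (FP : fin_products E).

Theorem ab_forget_left_adjoint : has_left_adjoint (ab_forget FP).
Proof.
apply left_adjoint_of_universal_arrows. intros A.
destruct (universal_ab_object HK HG (FP := FP) hE (A := A) (Phi := fun _ _ => True))
  as (L & a0 & _ & HL).
{ trivial. }
exists L, a0. intros M b. exact (HL M b Logic.I).
Qed.

Context (E' : category) (FP' : fin_products E') (F : functor E E')
  (HF : preserves_fin_products FP FP' F).

(** Universal arrows make [F] preserve jointly monic families, so that additivity
    of [fmap F a ∘ eta] can be tested after jointly monic homomorphisms. *)
Theorem ab_functor_left_adjoint :
  (forall B : E', exists (A : E) (eta : B ~> F A), universal_arrow eta) ->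
  has_left_adjoint (ab_functor HF).
Proof.
intros HU. apply left_adjoint_of_universal_arrows. intros B.
destruct (HU (ab_carrier B)) as (A & eta & Heta).
destruct (universal_ab_object HK HG (FP := FP) hE (A := A)
  (Phi := fun M a => additive (M := B) (N := ab_functor_obj HF M) (fmap F a ∘ eta)))
  as (L & a0 & Ha0 & HL).
{ intros V M L p Hmono a Ha T x y.
  assert (Hmono' : jointly_monic (fun v => fmap F (ab_map (p v)))).
  { intros S z z' e. destruct (HU S) as (S' & theta & Htheta).
    destruct (Htheta _ z) as [h [<- _]], (Htheta _ z') as [h' [<- _]].
    assert (h = h') as ->; [|reflexivity].
    apply Hmono. intros v. specialize (e v). cbn in e.
    rewrite !comp_A, <- !fmap_comp in e.
    destruct (Htheta _ (fmap F (ab_map (p v) ∘ h') ∘ theta)) as [t [_ Ht]].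
    transitivity t; [symmetry|]; apply Ht; [exact e | reflexivity]. }
  apply Hmono'. intros v.
  transitivity (hadd (M := ab_functor_obj HF (M v))
    (fmap F (ab_map (p v)) ∘ (fmap F a ∘ eta ∘ x))
    (fmap F (ab_map (p v)) ∘ (fmap F a ∘ eta ∘ y))).
  - specialize (Ha v T x y). rewrite fmap_comp in Ha. rewrite !comp_A. exact Ha.
  - symmetry. exact (hadd_hom (ab_functor_map HF (p v)) _ _). }
destruct (additive_hom Ha0) as [eta0 Heta0].
assert (eta0E : forall (M : ab_object FP) (h : ab_hom L M),
  fmap F (ab_map h) ∘ ab_map eta0 = fmap F (ab_map h ∘ a0) ∘ eta).
{ intros M h. rewrite fmap_comp, <- comp_A. f_equal. exact Heta0. }
exists L, eta0. intros M g.
destruct (Heta _ (ab_map g)) as [b [Hb Ub]].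
destruct (HL M b) as [h [Hh Uh]].
{ rewrite Hb. intros T x y. apply hadd_hom. }
exists h. split.
- apply ab_hom_eq. etransitivity; [|exact Hb]. etransitivity; [apply eta0E|].
  rewrite Hh. reflexivity.
- intros h' Hh'. apply Uh. symmetry. apply Ub.
  rewrite <- eta0E. exact (f_equal (@ab_map _ _ _ _) Hh').
Qed.

End AbAdjoints.

(** * Beck modules *)

Section BeckModules.
Context (C : category) (P : pullbacks C).

(** Composition with [f] is left adjoint to pullback along [f]. *)
Lemma pullback_universal_arrow (X Y : C) (f : X ~> Y) (B : slice X) :
  exists (A : slice Y) (eta : B ~> pullback_functor P f A), universal_arrow eta.
Proof.
destruct B as [D b].
assert (e : f ∘ b = f ∘ b ∘ idm D) by (symmetry; apply comp_1r).
exists (SliceObj (f ∘ b)), (@SliceHom C X (SliceObj b) (pullback_obj P f (SliceObj (f ∘ b)))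
  (pb_lift (P f (f ∘ b)) e) (pb_fst_lift (P f (f ∘ b)) e)).
intros [N n] [g Hg]. cbn in g, Hg.
assert (Hh : n ∘ (pb_snd (P f n) ∘ g) = f ∘ b).
{ rewrite comp_A, <- pb_comm, <- comp_A. f_equal. exact Hg. }
exists (@SliceHom C Y (SliceObj (f ∘ b)) (SliceObj n) (pb_snd (P f n) ∘ g) Hh). split.
- apply slice_hom_eq, pb_eq; cbn.
  + etransitivity; [apply comp_eql, pb_fst_lift|].
    etransitivity; [apply pb_fst_lift|]. symmetry. exact Hg.
  + etransitivity; [apply comp_eql, pb_snd_lift|].
    etransitivity; [symmetry; apply comp_A|].
    etransitivity; [apply f_equal, pb_snd_lift|]. apply comp_1r.
- intros [h Hh'] Ek. apply slice_hom_eq. cbn.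
  apply (f_equal (@s_map C X _ _)) in Ek. cbn in Ek. rewrite <- Ek.
  etransitivity; [apply comp_eql, pb_snd_lift|].
  etransitivity; [symmetry; apply comp_A|].
  etransitivity; [apply f_equal, pb_snd_lift|]. apply comp_1r.
Qed.

End BeckModules.

Theorem proposition3p26 (C : category) (hC : locally_presentable C) (P : pullbacks C) :
  (forall X : C, has_left_adjoint (beck_forget P X)) /\
  (forall (X Y : C) (f : X ~> Y), has_left_adjoint (beck_pullback P f)).
Proof.
destruct hC as (K & HK & hE & I & G & Hpres & Hgen).
assert (HG : generated K G).
{ split; [|exact Hgen]. intros i. exact (presentable_compact HK (Hpres i)). }
split.
- intros X.
  exact (ab_forget_left_adjoint HK (slice_cocomplete hE) (slice_generated _ hE HG) _).
- intros X Y f.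
  apply (ab_functor_left_adjoint HK (slice_cocomplete hE) (slice_generated _ hE HG)).
  apply pullback_universal_arrow.
Qed.
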